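(* Let $\sigma\colon\Sigma^+\to\Sigma^+$ be the left shift on $\Sigma^+=\{0,1\}^{\mathbb N}$. Let $\theta\in(0,1/4)$ and let $\boldsymbol a=\{a_n\}_{n\in\mathbb N_0}$ be a strictly decreasing sequence of positive numbers satisfying $$\frac{a_{n+1}}{a_n}=O(\theta^n)\qquad\text{as } n\to+\infty .$$ Let $\mathcal{PU}(\sigma)$ be the set of continuous functions $f\colon\Sigma^+\to\mathbb R$ such that there is a unique $f$-maximizing measure $\mu$ and $\mu$ is supported on a periodic orbit of $\sigma$. Then $\mathcal{PU}(\sigma)\cap \mathrm{lip}(\Sigma^+,d_{\boldsymbol a})$ is a prevalent set in the little Lipschitz space $\mathrm{lip}(\Sigma^+,d_{\boldsymbol a})$. Moreover, $\mathrm{lock}_\sigma(\Sigma^+,d_{\boldsymbol a})$ is a prevalent set in $\mathrm{lip}(\Sigma^+,d_{\boldsymbol a})$.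
   Context: Here $\mathbb N=\{1,2,3,\dots\}$ and $\mathbb N_0=\{0\}\cup\mathbb N$. The left shift is $\sigma(\{w_i\}_{i\in\mathbb N})=\{w_{i+1}\}_{i\in\mathbb N}$. Metric: for a strictly decreasing sequence $\boldsymbol a=\{a_n\}_{n\in\mathbb N_0}$ of positive numbers converging to $0$, $d_{\boldsymbol a}(\boldsymbol w,\boldsymbol z)=a_m$ for distinct $\boldsymbol w=\{w_n\},\boldsymbol z=\{z_n\}\in\Sigma^+$, where $m$ is the smallest positive integer with $w_m\ne z_m$, and $d_{\boldsymbol a}(\boldsymbol z,\boldsymbol z)=0$. Little Lipschitz space: $\mathrm{lip}(\Sigma^+,d_{\boldsymbol a})$ is the space of functions $f\colon\Sigma^+\to\mathbb R$ that are Lipschitz with respect to $d_{\boldsymbol a}$ and satisfy $\sup\{|f(x)-f(y)|: x,y\in\Sigma^+,\ d_{\boldsymbol a}(x,y)\le r\}=o(r)$ as $r\to0$. It is equipped with the norm $\|f\|_{\mathrm{Lip}}=\|f\|_\infty+\mathrm{LIP}_{d_{\boldsymbol a}}(f)$, where $\mathrm{LIP}_{d_{\boldsymbol a}}(f)=\sup\{|f(x)-f(y)|/d_{\boldsymbol a}(x,y): x\neq y\}$, and is a Banach space. Maximizing measures: for continuous $f\colon\Sigma^+\to\mathbb R$, an $f$-maximizing measure is a $\sigma$-invariant Borel probability measure $\mu$ on $\Sigma^+$ with $\int f\,d\mu=\max_{\nu}\int f\,d\nu$, the maximum being over all $\sigma$-invariant Borel probability measures $\nu$. Locking: $\mathrm{lock}_\sigma(\Sigma^+,d_{\boldsymbol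 a})$ is the set of $f\in\mathrm{lip}(\Sigma^+,d_{\boldsymbol a})$ having a unique maximizing measure $\nu$, with $\nu$ supported on a periodic orbit of $\sigma$, and such that $\nu$ is the unique maximizing measure of every function in $\mathrm{lip}(\Sigma^+,d_{\boldsymbol a})$ sufficiently close to $f$ in the norm $\|\cdot\|_{\mathrm{Lip}}$. Prevalence: let $V$ be a real topological vector space equipped with a complete metric. A Borel measure $\mu$ on $V$ is transverse to a Borel set $B\subseteq V$ if $\mu(\{x+v: x\in B\})=0$ for every $v\in V$. A Borel set $B\subseteq V$ is shy if there is a compactly supported Borel probability measure transverse to $B$. A subset $S\subseteq V$ is prevalent if $V\setminus S$ is contained in a shy Borel subset of $V$. *)

(* Defs.v *)
From HB Require Import structures.
From mathcomp Require Import all_boot all_order all_algebra.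
From mathcomp Require Import lra.
From mathcomp Require Import all_classical all_reals all_analysis.

Set Implicit Arguments.
Unset Strict Implicit.
Unset Printing Implicit Defensive.

Import Order.TTheory GRing.Theory Num.Theory.
Import numFieldNormedType.Exports.

Local Open Scope classical_set_scope.
Local Open Scope ring_scope.

(* The space {0,1}^N, N = {1,2,...}, is [cantor_space]: [nat -> bool] with the
   product topology.  Coordinates are numbered from 0 here, so the coordinate
   usually written w_{i+1} is [w i]. *)
Definition shift (w : cantor_space) : cantor_space := fun n => w n.+1.

(* Convergence to 0 is not required here: it follows from the growth
   condition [a (n+1) / a n = O(theta^n)] made on [a]. *)
Record decr_seq (R : realType) := DecrSeq {
  decr_seq_fun :> nat -> R;
  decr_seq_gt0 : forall n, 0 < decr_seq_fun n;
  decr_seq_lt : forall n, decr_seq_fun n.+1 < decr_seq_fun n }.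

Section LittleLipschitz.
Context {R : realType}.

(* [ex_minn h] is the first index, counted from 0, at which the sequences
   differ; hence the successor. *)
Definition dist_seq (a : nat -> R) (w z : cantor_space) : R :=
  if pselect (exists n, w n != z n) is left h then a (ex_minn h).+1 else 0.

Definition lipschitz_seq (a : nat -> R) (f : cantor_space -> R) : Prop :=
  exists L : R, forall x y, `|f x - f y| <= L * dist_seq a x y.

Definition osc_seq (a : nat -> R) (f : cantor_space -> R) (r : R) : R :=
  sup [set `|f p.1 - f p.2| | p in
        [set p : cantor_space * cantor_space | dist_seq a p.1 p.2 <= r]].

Definition is_little_lip (a : nat -> R) (f : cantor_space -> R) : Prop :=
  lipschitz_seq a f /\ osc_seq a f =o_ (0^'+) (fun r : R => r).

Definition little_lip_pred (a : nat -> R) : {pred cantor_space -> R} :=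
  [pred f | `[< is_little_lip a f >]].

Record little_lip (a : decr_seq R) := LittleLip {
  little_lip_fun :> cantor_space -> R;
  little_lipP : little_lip_fun \in little_lip_pred a }.

HB.instance Definition _ (a : decr_seq R) :=
  [isSub for @little_lip_fun a].
HB.instance Definition _ (a : decr_seq R) :=
  [Choice of little_lip a by <:].

Definition sup_norm (f : cantor_space -> R) : R :=
  sup [set `|f x| | x in [set: cantor_space]].

Definition lip_const (a : nat -> R) (f : cantor_space -> R) : R :=
  sup [set `|f p.1 - f p.2| / dist_seq a p.1 p.2 | p in
        [set p : cantor_space * cantor_space | p.1 <> p.2]].

Definition lip_norm (a : nat -> R) (f : cantor_space -> R) : R :=
  sup_norm f + lip_const a f.

End LittleLipschitz.

Section LittleLipschitzBanach.
Context {R : realType} (a : decr_seq R).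
Implicit Types (f g : cantor_space -> R) (x y : cantor_space).
Local Notation d := (dist_seq a).

Lemma dist_seqxx x : d x x = 0.
Proof. by rewrite /dist_seq; case: pselect => // h; exfalso; case: h => n; rewrite eqxx. Qed.

Lemma dist_seq_gt0 x y : x <> y -> 0 < d x y.
Proof.
move=> xy; rewrite /dist_seq; case: pselect => [h|h]; first exact: decr_seq_gt0.
exfalso; apply: xy; apply/funext => n; apply/eqP; apply: contrapT => /negP ?.
by apply: h; exists n.
Qed.

Lemma dist_seq_ge0 x y : 0 <= d x y.
Proof.
by rewrite /dist_seq; case: pselect => // h; exact/ltW/decr_seq_gt0.
Qed.

Lemma dist_seq_le x y : d x y <= a 0%N.
Proof.
have a_le n : a n <= a 0%N.
  by elim: n => // n; apply: le_trans; exact/ltW/decr_seq_lt.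
by rewrite /dist_seq; case: pselect => // _; exact/ltW/decr_seq_gt0.
Qed.

Lemma osc_seq_ub f (L r : R) : (forall x y, `|f x - f y| <= L * d x y) ->
  0 <= L ->
  has_sup [set `|f p.1 - f p.2| | p in
        [set p : cantor_space * cantor_space | d p.1 p.2 <= r]] \/ r < 0.
Proof.
move=> fL L0; have [r0|] := leP 0 r; [left; split | by right].
  by exists `|f point - f point|; exists (point, point) => //=; rewrite dist_seqxx.
by exists (L * r) => _ [[x y] /= xyr <-]; apply: le_trans (fL x y) _; exact: ler_wpM2l.
Qed.

Lemma lipschitz_ge0 f : lipschitz_seq a f ->
  exists2 L : R, 0 <= L & forall x y, `|f x - f y| <= L * d x y.
Proof.
move=> [L fL]; exists `|L| => // x y; apply: le_trans (fL x y) _.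
by apply: ler_wpM2r; [exact: dist_seq_ge0 | exact: ler_norm].
Qed.

Lemma is_little_lipE f : is_little_lip a f <-> lipschitz_seq a f /\
  forall e, 0 < e -> exists2 r : R, 0 < r &
    forall x y, d x y < r -> `|f x - f y| <= e * d x y.
Proof.
split=> -[lf]; have [L L0 fL] := lipschitz_ge0 lf.
- move=> /eqoP fo; split=> // e e0; have := fo e e0.
  rewrite /= near_withinE => /nbhs_ballP[r /= r0 rP]; exists r => // x y xyr.
  have [->|/eqP xy] := eqVneq x y.
    by rewrite subrr normr0 mulr_ge0 ?dist_seq_ge0// ltW.
  have d0 := dist_seq_gt0 xy.
  have := rP (d x y); rewrite -ball_normE /= sub0r normrN ger0_norm ?dist_seq_ge0//.
  move=> /(_ xyr d0) h.
  apply: le_trans h; apply: le_trans (ler_norm _).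
  apply: ub_le_sup; last by exists (x, y) => /=.
  by have [[]|] := osc_seq_ub (d x y) fL L0; rewrite // ltNge dist_seq_ge0.
- move=> fo; split=> //; apply/eqoP => e e0.
  have [r r0 rP] := fo e e0.
  near=> s.
  have s0 : 0 < s by near: s; exact: nbhs_right_gt.
  have sr : s < r by near: s; exact: nbhs_right_lt.
  rewrite (ger0_norm (ltW s0)).
  have ubs : ubound [set `|f p.1 - f p.2| | p in
        [set p : cantor_space * cantor_space | d p.1 p.2 <= s]] (e * s).
    move=> _ [[x y] /= xys <-]; apply: le_trans (rP _ _ (le_lt_trans xys sr)) _.
    by rewrite ler_pM2l.
  have [hs|] := osc_seq_ub s fL L0; last by rewrite ltNge ltW.
  rewrite ger0_norm; first by apply: ge_sup => //; case: hs.
  apply: le_trans (ub_le_sup hs.2 _); first exact: (normr_ge0 (f point - f point)).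
  by exists (point, point) => //=; rewrite dist_seqxx ltW.
Unshelve. all: by end_near. Qed.

Lemma little_lip_predP f :
  reflect (is_little_lip a f) (f \in little_lip_pred a).
Proof. exact: asboolP. Qed.

Lemma little_lip_submod : submod_closed (little_lip_pred a).
Proof.
split.
  apply/little_lip_predP/is_little_lipE; split.
    by exists 0 => x y; rewrite subrr normr0 mul0r.
  move=> e e0; exists 1 => // x y _.
  by rewrite subrr normr0 mulr_ge0 ?dist_seq_ge0// ltW.
move=> k f g /little_lip_predP/is_little_lipE[lf fo].
move=> /little_lip_predP/is_little_lipE[lg go].
have [L L0 fL] := lipschitz_ge0 lf; have [M M0 gM] := lipschitz_ge0 lg.
have norm_le x y : `|(k *: f + g) x - (k *: f + g) y| <=
    `|k| * `|f x - f y| + `|g x - g y|.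
  rewrite -normrM; apply: le_trans (ler_normD _ _).
  by rewrite !fctE /GRing.scale/= mulrBr opprD addrACA.
apply/little_lip_predP/is_little_lipE; split.
  exists (`|k| * L + M) => x y; apply: le_trans (norm_le x y) _.
  by rewrite mulrDl -mulrA lerD// ler_wpM2l.
move=> e e0; have k0 : 0 < `|k| + 1 by rewrite ltr_wpDl.
have [r r0 fr] := fo (e / 2 / (`|k| + 1)) (divr_gt0 (divr_gt0 e0 (ltr0Sn _ _)) k0).
have [s s0 gs] := go (e / 2) (divr_gt0 e0 (ltr0Sn _ _)).
exists (Order.min r s); first by rewrite lt_min r0.
move=> x y; rewrite lt_min => /andP[xr xs]; apply: le_trans (norm_le x y) _.
rewrite [e in leRHS]splitr mulrDl lerD//; last exact: gs.
apply: (@le_trans _ _ ((`|k| + 1) * `|f x - f y|)).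
  by rewrite ler_wpM2r// lerDl.
by rewrite mulrC -ler_pdivlMr// mulrAC; exact: fr.
Qed.

HB.instance Definition _ :=
  GRing.isSubmodClosed.Build R (cantor_space -> R) (little_lip_pred a)
    little_lip_submod.
HB.instance Definition _ := [SubChoice_isSubLmodule of little_lip a by <:].

Implicit Types F G : little_lip a.

Lemma little_lip_addE F G x : (F + G : little_lip a) x = F x + G x. Proof. by []. Qed.
Lemma little_lip_oppE F x : (- F : little_lip a) x = - F x. Proof. by []. Qed.
Lemma little_lip_subE F G x : (F - G : little_lip a) x = F x - G x. Proof. by []. Qed.
Lemma little_lip_scaleE (k : R) F x : (k *: F : little_lip a) x = k * F x. Proof. by []. Qed.

Lemma little_lip_bounds F :
  lipschitz_seq a F /\
  forall e, 0 < e -> exists2 r : R, 0 < r &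
    forall x y, d x y < r -> `|F x - F y| <= e * d x y.
Proof. by apply/is_little_lipE/little_lip_predP/little_lipP. Qed.

Lemma has_sup_sup_norm F : has_sup [set `|F x| | x in [set: cantor_space]].
Proof.
have [lF _] := little_lip_bounds F; have [L L0 fL] := lipschitz_ge0 lF.
split; first by exists `|F point|; exists point.
exists (`|F point| + L * a 0%N) => _ [x _ <-].
rewrite -[F x](subrK (F point)) addrC; apply: le_trans (ler_normD _ _) _.
rewrite lerD2l; apply: le_trans (fL _ _) _.
by rewrite ler_wpM2l// dist_seq_le.
Qed.

Lemma has_sup_lip_const F :
  has_sup [set `|F p.1 - F p.2| / d p.1 p.2 | p in
        [set p : cantor_space * cantor_space | p.1 <> p.2]].
Proof.
have [lF _] := little_lip_bounds F; have [L L0 fL] := lipschitz_ge0 lF.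
split.
  pose p : cantor_space * cantor_space := (fun=> true, fun=> false).
  exists (`|F p.1 - F p.2| / d p.1 p.2); exists p => //= /(congr1 (@^~ 0%N)).
  by [].
exists L => _ [[x y] /= xy <-].
by rewrite ler_pdivrMr// dist_seq_gt0.
Qed.

Lemma sup_norm_ge F x : `|F x| <= sup_norm F.
Proof. by apply: ub_le_sup; [exact: (has_sup_sup_norm F).2 | exists x]. Qed.

Lemma lip_const_ge F x y : `|F x - F y| <= lip_const a F * d x y.
Proof.
have [->|/eqP xy] := eqVneq x y; first by rewrite subrr normr0 dist_seqxx mulr0.
rewrite -ler_pdivrMr ?dist_seq_gt0//.
by apply: ub_le_sup; [exact: (has_sup_lip_const F).2 | exists (x, y)].
Qed.

Lemma sup_norm_le F (M : R) : (forall x, `|F x| <= M) -> sup_norm F <= M.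
Proof.
by move=> FM; apply: ge_sup; [exact: (has_sup_sup_norm F).1 | move=> _ [x _ <-]].
Qed.

Lemma lip_const_le F (M : R) :
  (forall x y, `|F x - F y| <= M * d x y) -> lip_const a F <= M.
Proof.
move=> FM; apply: ge_sup; first exact: (has_sup_lip_const F).1.
by move=> _ [[x y] /= xy <-]; rewrite ler_pdivrMr ?dist_seq_gt0.
Qed.

Lemma sup_norm_ge0 F : 0 <= sup_norm F.
Proof. exact: le_trans (sup_norm_ge F point). Qed.

Lemma lip_const_ge0 F : 0 <= lip_const a F.
Proof.
have [[z [p pP pz]] hu] := has_sup_lip_const F.
apply: le_trans (ub_le_sup hu (ex_intro2 _ _ p pP erefl)).
by rewrite divr_ge0// dist_seq_ge0.
Qed.

Lemma lip_norm_triangle F G :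
  lip_norm a (F + G : little_lip a) <= lip_norm a F + lip_norm a G.
Proof.
rewrite /lip_norm addrACA lerD//.
  apply: sup_norm_le => x; apply: le_trans (ler_normD _ _) _.
  by rewrite lerD// sup_norm_ge.
apply: lip_const_le => x y; rewrite !little_lip_addE opprD addrACA mulrDl.
by apply: le_trans (ler_normD _ _) _; rewrite lerD// lip_const_ge.
Qed.

Lemma lip_norm_scale_le (k : R) F : lip_norm a (k *: F : little_lip a) <= `|k| * lip_norm a F.
Proof.
rewrite /lip_norm mulrDr lerD//.
  by apply: sup_norm_le => x; rewrite little_lip_scaleE normrM ler_wpM2l// sup_norm_ge.
apply: lip_const_le => x y; rewrite !little_lip_scaleE -mulrBr normrM -mulrA.
by rewrite ler_wpM2l// lip_const_ge.
Qed.

Lemma lip_norm0_eq0 F : lip_norm a F = 0 -> F = 0.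
Proof.
move=> F0; apply/val_inj/funext => x; apply/eqP; rewrite -normr_le0.
apply: le_trans (sup_norm_ge F x) _; rewrite -F0 lerDl; exact: lip_const_ge0.
Qed.

Lemma lip_normZ (k : R) F : lip_norm a (k *: F : little_lip a) = `|k| * lip_norm a F.
Proof.
apply/eqP; rewrite eq_le; apply/andP; split; first exact: lip_norm_scale_le.
have [->|k0] := eqVneq k 0.
  by rewrite normr0 mul0r /lip_norm addr_ge0 ?sup_norm_ge0 ?lip_const_ge0.
rewrite -ler_pdivlMl ?normr_gt0// -normfV.
have := lip_norm_scale_le k^-1 (k *: F).
by rewrite scalerA mulVf// scale1r.
Qed.

HB.instance Definition _ := @Lmodule_isNormed.Build R (little_lip a)
  (fun F => lip_norm a F) lip_norm_triangle lip_normZ lip_norm0_eq0.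

Lemma little_lip_normE F : `|F| = sup_norm F + lip_const a F.
Proof. by []. Qed.

Lemma little_lip_complete (FF : set_system (little_lip a)) :
  ProperFilter FF -> cauchy FF -> cvg FF.
Proof.
move=> PFF /cauchyP cF.
have norm_ge (H : little_lip a) x : `|H x| <= `|H|.
  by apply: le_trans (sup_norm_ge H x) _; rewrite lerDl lip_const_ge0.
have cx x : cvg ((fun G : little_lip a => G x) @ FF).
  apply: R_complete; apply/cauchyP => e e0; have [G GP] := cF e e0.
  exists (G x); apply: (@filterS _ FF _ _ _ _ GP) => H; rewrite -!ball_normE /=.
  by apply: le_lt_trans; exact: (norm_ge (G - H)).
pose g x := lim ((fun G : little_lip a => G x) @ FF).
have gP x : (fun G : little_lip a => G x) @ FF --> g x by exact: cx.
have appr (e : R) : 0 < e -> exists G : little_lip a, [/\ FF (ball G e),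
    forall x, `|G x - g x| <= e &
    forall x y, `|(G x - g x) - (G y - g y)| <= e * d x y].
  move=> e0; have [G GP] := cF e e0; exists G; split=> //.
    move=> x; have : (fun H : little_lip a => `|G x - H x|) @ FF --> `|G x - g x|.
      by apply: cvg_norm; apply: cvgB; [exact: cvg_cst | exact: gP].
    move/cvgr_to_le; apply.
    apply: (@filterS _ FF _ _ _ _ GP) => H; rewrite -ball_normE /= => /ltW; apply: le_trans.
    exact: (norm_ge (G - H)).
  move=> x y; have : (fun H : little_lip a => `|(G x - H x) - (G y - H y)|) @ FF
      --> `|(G x - g x) - (G y - g y)|.
    by apply: cvg_norm; apply: cvgB; apply: cvgB; by [exact: cvg_cst | exact: gP].
  move/cvgr_to_le; apply.
  apply: (@filterS _ FF _ _ _ _ GP) => H; rewrite -ball_normE /= => /ltW GH.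
  apply: le_trans (lip_const_ge (G - H) _ _) _.
  rewrite ler_wpM2r ?dist_seq_ge0//; apply: le_trans GH.
  by rewrite little_lip_normE lerDr sup_norm_ge0.
have g_le (G : little_lip a) x y :
    `|g x - g y| <= `|(G x - g x) - (G y - g y)| + `|G x - G y|.
  rewrite distrC -[X in `|X| <= _](_ : (G x - g x) - (G y - g y) - (G x - G y) = _).
    exact: ler_normB.
  by rewrite !opprB addrACA addrC; lra.
have g_lip : g \in little_lip_pred a.
  apply/little_lip_predP/is_little_lipE; split.
    have [G [_ _ GL]] := appr 1 ltr01.
    have [/lipschitz_ge0[L L0 GLip] _] := little_lip_bounds G.
    exists (1 + L) => x y; apply: le_trans (g_le G x y) _.
    by rewrite mulrDl lerD.
  move=> e e0; have e20 : 0 < e / 2 by rewrite divr_gt0.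
  have [G [_ _ GL]] := appr _ e20.
  have [_ /(_ _ e20)[r r0 Gr]] := little_lip_bounds G.
  exists r => // x y xyr; apply: le_trans (g_le G x y) _.
  by rewrite [e in leRHS]splitr mulrDl lerD// Gr.
pose Gg : little_lip a := LittleLip g_lip.
apply/cvg_ex; exists Gg; apply/cvgrPdist_lt => e e0.
have e40 : 0 < e / 4 by rewrite divr_gt0.
have [G [GP Gs GL]] := appr _ e40.
have GGg : `|G - Gg| <= e / 4 + e / 4.
  by rewrite little_lip_normE lerD//; [exact: sup_norm_le | exact: lip_const_le].
near=> H.
have GH : `|G - H| < e / 4 by near: H; rewrite -ball_normE in GP.
rewrite distrC -(subrKA G); apply: le_lt_trans (ler_normD _ _) _.
rewrite (distrC H); lra.
Unshelve. all: by end_near. Qed.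

HB.instance Definition _ :=
  Uniform_isComplete.Build (little_lip a) little_lip_complete.

End LittleLipschitzBanach.

Notation borel T := (g_sigma_algebraType (@open T)).

Section MaximizingMeasures.
Context {R : realType}.
Local Notation Prob := (probability (borel cantor_space) R).

Definition shift_invariant (mu : Prob) : Prop :=
  forall A : set (borel cantor_space), measurable A ->
    mu (shift @^-1` A) = mu A.

Definition maximizing (f : cantor_space -> R) (mu : Prob) : Prop :=
  shift_invariant mu /\
  forall nu : Prob, shift_invariant nu ->
    (\int[nu]_w (f w)%:E <= \int[mu]_w (f w)%:E)%E.

(* A [probability] is a function on all subsets that is constrained on
   measurable sets only, so measures are compared on the Borel sets. *)
Definition unique_maximizing (f : cantor_space -> R) (mu : Prob) : Prop :=
  maximizing f mu /\
  forall nu : Prob, maximizing f nu ->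
    forall A : set (borel cantor_space), measurable A -> nu A = mu A.

(* The orbit is finite, hence closed, so having full measure on it is the same
   as having support contained in it. *)
Definition on_periodic_orbit (mu : Prob) : Prop :=
  exists (w : cantor_space) (p : nat),
    [/\ (0 < p)%N, iter p shift w = w &
        mu [set iter k shift w | k in [set: nat]] = 1%E].

Definition PU : set (cantor_space -> R) :=
  [set f | continuous f /\
    exists mu : Prob, unique_maximizing f mu /\ on_periodic_orbit mu].

Definition lock_shift (a : decr_seq R) : set (little_lip a) :=
  [set f : little_lip a | exists mu : Prob,
    [/\ unique_maximizing f mu, on_periodic_orbit mu &
        \forall g \near f, unique_maximizing (g : little_lip a) mu]].

End MaximizingMeasures.
Arguments lock_shift {R} a.

Section Prevalence.
Context {R : realType} {V : completeNormedModType R}.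

Definition transverse (mu : {measure set (borel V) -> \bar R}) (B : set V) : Prop :=
  forall v : V, mu [set x + v | x in B] = 0%E.

(* [V] is Hausdorff, so compact sets are Borel; compact support is expressed by
   full measure on some compact set. *)
Definition shy (B : set V) : Prop :=
  exists mu : probability (borel V) R,
    (exists K : set V, compact K /\ mu K = 1%E) /\ transverse mu B.

Definition prevalent (S : set V) : Prop :=
  exists B : set V,
    [/\ (measurable : set (set (borel V))) B, shy B & ~` S `<=` B].

End Prevalence.

(* Main.v *)
From HB Require Import structures.
From mathcomp Require Import all_boot all_order all_algebra.
From mathcomp Require Import ring lra zify.
From mathcomp Require Import all_classical all_reals all_analysis measurable_realfun.
Require Import Defs.

Set Implicit Arguments.
Unset Strict Implicit.
Unset Printing Implicit Defensive.

Import Order.TTheory GRing.Theory Num.Theory.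
Import numFieldNormedType.Exports.
Local Open Scope classical_set_scope.
Local Open Scope ring_scope.

(** The proof is a probabilistic argument on finite graphs. A function of the
    first [m.+1] coordinates is a weight on the edges of the graph whose vertices
    are the words of length [m] and whose edges are the words of length [m.+1];
    invariant measures are mixtures of closed walks, and the maximal mean weight
    is attained by a simple cycle.

    _Locking_ ([locking], [lock_of_untied]). Let [F] be approximated by such a
    function [phi] with an error of the order of [a m.+2], as every Lipschitz
    function is. If the best simple cycle for [phi] beats every other one by a
    large multiple of [a m.+2], then all orbits follow it: an excursion off the
    cycle costs more than the approximation can return, and while an orbit stays
    with the cycle the errors add up to a multiple of [a m.+2], as the distances
    between the two grow at least geometrically. The periodic orbit then carries
    the only maximizing measure ([orbit_prob_unique]), for [F] and for all
    functions near [F].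

    _Isolation_ ([tied_at_isolated]). A random weight on each edge produces such
    a gap. With the weights of the other edges given, raising the weight of [e]
    lifts the means of the cycles through [e] with slope at least [2 ^- m], since
    simple cycles have length at most [2 ^ m], and does not move the others;
    so if the weight of [e] takes values on a grid of mesh at least [2 ^ m] times
    the required gap, then at most one value makes the two classes tie. If no
    edge sees a tie, the best cycle is isolated ([untied_gap]). With [N] values
    for each edge a tie has probability at most [2 ^ m.+1 / N] for the [2 ^ m.+1]
    edges.

    _The transverse measure_ ([noise], [coin_not_lock]). The random function is
    the sum over [n] of random weights on the words of length [n], of size
    [rho ^ n * a n] with [rho < 1], and with about [n * 2 ^ n] values each. It
    converges in norm, depends continuously on the coins and so is supported by
    the compact image of the Cantor space. At level [n] the mesh is about
    [rho ^ n * a n / (n * 2 ^ n)], which must exceed [2 ^ n * a n.+1] up to a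
    constant: this holds when [a n.+1 / a n] is of the order of [theta ^ n] and
    [4 * theta < rho] ([growth]), whence the threshold 1/4. So for any [f] the
    probability that [f] plus the noise fails to lock is of order [1 / n] for
    all large [n], that is, zero. Since locking is an open condition, the
    functions that do not lock form a closed, hence Borel, shy set. *)

(** * Words, simple cycles and loop removal *)

Definition agree (n : nat) (x y : cantor_space) : Prop :=
  forall i, (i < n)%N -> x i = y i.

Lemma iter_shiftE k (x : cantor_space) i : iter k shift x i = x (k + i)%N.
Proof. by elim: k i => [|k IH] i //=; rewrite /shift IH addnS. Qed.

Lemma iter_shift_add i j (x : cantor_space) :
  iter i shift (iter j shift x) = iter (i + j) shift x.
Proof. by rewrite iterD. Qed.

Lemma agreexx n x : agree n x x. Proof. by []. Qed.

Lemma agree_sym n x y : agree n x y -> agree n y x.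
Proof. by move=> h i /h. Qed.

Lemma agree_trans n y x z : agree n x y -> agree n y z -> agree n x z.
Proof. by move=> h g i ni; rewrite h ?g. Qed.

Lemma agree_le m n x y : (m <= n)%N -> agree n x y -> agree m x y.
Proof. by move=> mn h i im; apply: h; apply: leq_trans mn. Qed.

Lemma agree_iter k n x y : agree (k + n) x y ->
  agree n (iter k shift x) (iter k shift y).
Proof. by move=> h i ni; rewrite !iter_shiftE h// ltn_add2l. Qed.

Lemma agree_shift n x y : agree n.+1 x y -> agree n (shift x) (shift y).
Proof. exact: (@agree_iter 1). Qed.

Section Words.
Variable n : nat.

Definition word (x : cantor_space) : n.-tuple bool := [tuple x i | i < n].

Lemma wordP x y : word x = word y <-> agree n x y.
Proof.
split=> [e i ni|e].
  by have := congr1 (fun t => tnth t (Ordinal ni)) e; rewrite !tnth_mktuple.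
by apply: eq_mktuple => i; exact: e.
Qed.
End Words.

Lemma word_pigeonhole m k (x : cantor_space) : (2 ^ m < k)%N ->
  exists i j, [/\ (i < j)%N, (j < k)%N &
    agree m (iter i shift x) (iter j shift x)].
Proof.
move=> mk; pose f (i : 'I_k) := word m (iter i shift x).
have /injectivePn[i [j ij /wordP e]] : ~~ injectiveb f.
  by apply/negP => /injectiveP/leq_card; rewrite card_tuple card_bool card_ord leqNgt mk.
wlog lij : i j ij e / (i < j)%N; last by exists i, j.
move=> H; have [/H|/H|/val_inj /eqP] := ltngtP i j.
- exact.
- by apply; rewrite 1?eq_sym//; exact: agree_sym.
- by rewrite (negPf ij).
Qed.

(** A simple closed walk of the graph whose vertices are the words of length
    [m] and whose edges are the words of length [m.+1], presented by the
    periodic sequence that reads it. *)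
Definition simple_cycle (m : nat) (w : cantor_space) (p : nat) : Prop :=
  [/\ (0 < p)%N, iter p shift w = w &
    forall i j, (i < j)%N -> (j < p)%N ->
      ~ agree m (iter i shift w) (iter j shift w)].

Lemma simple_cycle_le m w p : simple_cycle m w p -> (p <= 2 ^ m)%N.
Proof.
move=> [p0 _ sw]; rewrite leqNgt; apply/negP => /(@word_pigeonhole m p w).
by move=> [i [j [ij jp]]]; exact: sw.
Qed.

Lemma iter_shift_mod p w i : iter p shift w = w ->
  iter i shift w = iter (i %% p) shift w.
Proof.
move=> pw; rewrite {1}(divn_eq i p) addnC iterD; congr iter.
by elim: (i %/ p)%N => // q IH; rewrite mulSn iterD IH.
Qed.

(** Along a simple cycle a vertex determines the position, hence the whole
    future. *)
Lemma simple_cycle_eq m w p i j : simple_cycle m w p ->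
  agree m (iter i shift w) (iter j shift w) -> iter i shift w = iter j shift w.
Proof.
move=> [p0 pw sw]; rewrite (iter_shift_mod i pw) (iter_shift_mod j pw).
have ip : (i %% p < p)%N by rewrite ltn_mod.
have jp : (j %% p < p)%N by rewrite ltn_mod.
move=> h; have [ij|ij|->//] := ltngtP (i %% p)%N (j %% p)%N.
  by case: (sw _ _ ij jp h).
by case: (sw _ _ ij ip (agree_sym h)).
Qed.

(** The length of a simple cycle is the least period of each of its points. *)
Lemma simple_cycle_period m w p c q j : simple_cycle m w p ->
  simple_cycle m c q -> c = iter j shift w -> p = q.
Proof.
move=> [p0 pw sw] [q0 qc sc] cj.
have pc : iter p shift c = c by rewrite cj iter_shift_add addnC -iter_shift_add pw.
have [pq|qp|//] := ltngtP p q.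
  by case: (sc 0%N p p0 pq); rewrite pc.
have qw : iter q shift w = w.
  have wj : iter (p - j %% p) shift c = w.
    rewrite cj (iter_shift_mod j pw) iter_shift_add subnK ?pw//.
    by apply/ltnW; rewrite ltn_mod.
  by rewrite -wj iter_shift_add addnC -iter_shift_add qc.
by case: (sw 0%N q q0 qp); rewrite qw.
Qed.

(** Cutting out the first loop: up to the first return to an already visited
    vertex, the loop that has just closed is simple, and the walk that skips it
    is still a walk. *)
Lemma first_loop m (y : cantor_space) :
  exists i p w z, [/\ (i + p <= 2 ^ m)%N, simple_cycle m w p,
    agree (p + m) w (iter i shift y), agree (i + m) z y &
    iter i shift z = iter (i + p) shift y].
Proof.
pose Q j := `[< exists2 i, (i < j)%N & agree m (iter i shift y) (iter j shift y) >].
have exQ : exists j, Q j.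
  have [i [j [ij _ h]]] := word_pigeonhole y (ltnSn (2 ^ m)).
  by exists j; apply/asboolP; exists i.
have [j /asboolP[i ij aij] jmin] := ex_minnP exQ.
have jle : (j <= 2 ^ m)%N.
  have [i' [j' [ij' jk h]]] := word_pigeonhole y (ltnSn (2 ^ m)).
  apply: leq_trans (jmin j' _) _; last by rewrite -ltnS.
  by apply/asboolP; exists i'.
have nagree i' j' : (i' < j')%N -> (j' < j)%N ->
    ~ agree m (iter i' shift y) (iter j' shift y).
  move=> ij' jj h; have : Q j' by apply/asboolP; exists i'.
  by move/jmin; rewrite leqNgt jj.
set p := (j - i)%N.
have p0 : (0 < p)%N by rewrite subn_gt0.
have jE : j = (i + p)%N by rewrite subnKC// ltnW.
have loop l : (l < m)%N -> y (i + l)%N = y (i + (p + l))%N.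
  by move=> lm; have := aij l lm; rewrite !iter_shiftE jE addnA.
pose w : cantor_space := fun l => y (i + l %% p)%N.
(* [w] repeats the letters of one turn of the loop, and [y] repeats them too for
   [m] more letters, because the loop returns to the same word. *)
have wy : agree (p + m) w (iter i shift y).
  move=> l; rewrite iter_shiftE /w.
  elim/ltn_ind: l => l IH lpm.
  have [lp|pl] := ltnP l p; first by rewrite modn_small.
  have e : l = (p + (l - p))%N by rewrite subnKC.
  rewrite e modnDl IH; last 2 first.
  - by rewrite ltn_subrL p0 (leq_trans p0 pl).
  - by rewrite (leq_ltn_trans (leq_subr _ _)).
  by rewrite loop// -(ltn_add2l p) -e.
exists i, p, w, (fun l => if (l < i)%N then y l else y (l + p)%N); split.
- by rewrite -jE.
- split=> //.
    by apply/funext => l; rewrite iter_shiftE /w modnDl.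
  move=> i' j' ij' jp; have h k : (k < p)%N ->
      agree m (iter k shift w) (iter (k + i) shift y).
    move=> kp; rewrite -iter_shift_add; apply: agree_iter.
    by apply: agree_le wy; rewrite leq_add2r ltnW.
  move=> e; apply: (nagree (i' + i)%N (j' + i)%N); rewrite ?ltn_add2r//.
    by rewrite jE addnC ltn_add2l.
  apply: agree_trans (agree_trans e (h _ jp)).
  by apply: agree_sym; apply: h; exact: ltn_trans jp.
- exact: wy.
- move=> l lim; case: ltnP => // il.
  have e : l = (i + (l - i))%N by rewrite subnKC.
  by rewrite {1}e -addnA (addnC _ p) -loop -?e// -(ltn_add2l i) -e.
- apply/funext => l; rewrite !iter_shiftE.
  by rewrite ltnNge leq_addr/=; congr (y _); rewrite addnAC.
Qed.

Section BirkhoffSums.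
Context {R : realType}.
Implicit Types phi psi : cantor_space -> R.

Definition birkhoff phi k (x : cantor_space) : R :=
  \sum_(i < k) phi (iter i shift x).

Definition local_fun n phi := forall x y, agree n x y -> phi x = phi y.

Lemma birkhoffD phi psi k x :
  birkhoff (fun x => phi x + psi x) k x = birkhoff phi k x + birkhoff psi k x.
Proof. exact: big_split. Qed.

Lemma birkhoffZ c phi k x :
  birkhoff (fun x => c * phi x) k x = c * birkhoff phi k x.
Proof. by rewrite /birkhoff mulr_sumr. Qed.

Lemma birkhoff_cst c k x : birkhoff (fun=> c) k x = k%:R * c.
Proof. by rewrite /birkhoff sumr_const card_ord mulr_natl. Qed.

Lemma ler_birkhoff phi psi k x : (forall x, phi x <= psi x) ->
  birkhoff phi k x <= birkhoff psi k x.
Proof. by move=> h; apply: ler_sum => i _. Qed.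

Lemma birkhoff_cat phi k l x :
  birkhoff phi (k + l) x = birkhoff phi k x + birkhoff phi l (iter k shift x).
Proof.
rewrite /birkhoff big_split_ord/=; congr (_ + _); apply: eq_bigr => i _.
by rewrite iter_shift_add addnC.
Qed.

Lemma birkhoff_agree m phi k x y : local_fun m.+1 phi -> agree (k + m) x y ->
  birkhoff phi k x = birkhoff phi k y.
Proof.
move=> lphi xy; apply: eq_bigr => i _; apply: lphi; apply: agree_iter.
by apply: agree_le xy; rewrite addnS -addSn leq_add2r.
Qed.

Lemma birkhoff_rot phi p w j : iter p shift w = w ->
  birkhoff phi p (iter j shift w) = birkhoff phi p w.
Proof.
move=> pw; elim: j => //= j <-; set v := iter j shift w.
have pv : iter p shift v = v by rewrite /v iter_shift_add addnC -iter_shift_add pw.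
have := birkhoff_cat phi 1 p v; rewrite addnC birkhoff_cat pv addrC.
by rewrite -[iter 1 shift v]/(shift v) => /addrI.
Qed.

(** A long walk is a short one with simple cycles inserted, and these do not
    raise its weight; walks with more than [2 ^ m] steps contain a loop. *)
Lemma birkhoff_le_of_cycles m psi (D : R) : local_fun m.+1 psi -> 0 <= D ->
  (forall x, psi x <= D) ->
  (forall w p, simple_cycle m w p -> birkhoff psi p w <= 0) ->
  forall k y, birkhoff psi k y <= (2 ^ m)%:R * D.
Proof.
move=> lpsi D0 psiD cyc; elim/ltn_ind => k IH y.
have [km|mk] := leqP k (2 ^ m).
  apply: (le_trans (ler_birkhoff k y psiD)).
  by rewrite birkhoff_cst ler_wpM2r// ler_nat.
have [i [p [w [z [ipm sw wy zy zi]]]]] := first_loop m y.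
have [p0 _ _] := sw.
have ipk : (i + p <= k)%N by exact: leq_trans ipm (ltnW mk).
have kp : (i + (k - (i + p)) < k)%N by lia.
apply: le_trans (IH _ kp z).
rewrite -{1}(subnKC ipk) !birkhoff_cat zi -(birkhoff_agree lpsi zy).
rewrite -(birkhoff_agree lpsi wy).
by rewrite lerD2r gerDl cyc.
Qed.

End BirkhoffSums.

(** * Distances and neighbourhoods of a periodic orbit *)

Section Metric.
Context {R : realType} (a : decr_seq R).
Local Notation d := (dist_seq a).

Lemma decr_seq_le i j : (i <= j)%N -> a j <= a i.
Proof.
by move=> ij; apply/(nonincreasing_seqP a).1 => // n; exact/ltW/decr_seq_lt.
Qed.

Lemma first_diff (x y : cantor_space) : x <> y ->
  exists2 k, agree k x y & x k != y k.
Proof.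
move=> xy; have ex : exists k, x k != y k.
  apply: contrapT => /forallNP h; apply: xy; apply/funext => k.
  by have /negP/negPn/eqP := h k.
have [k kP kmin] := ex_minnP ex; exists k => // i ik; apply/eqP/negPn/negP.
by move/kmin; rewrite leqNgt ik.
Qed.

Lemma dist_seqE k x y : agree k x y -> x k != y k -> d x y = a k.+1.
Proof.
move=> xy kP; rewrite /dist_seq; case: pselect => [h|[]]; last by exists k.
have [j jP jmin] := ex_minnP h; congr (a _.+1); apply/eqP.
rewrite eqn_leq (jmin _ kP)/= leqNgt; apply/negP => /xy /eqP.
by rewrite (negPf jP).
Qed.

Lemma dist_agree n x y : agree n x y -> d x y <= a n.+1.
Proof.
move=> xy; have [->|/eqP/first_diff[k kxy kP]] := eqVneq x y.
  by rewrite dist_seqxx ltW// decr_seq_gt0.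
rewrite (dist_seqE kxy kP) decr_seq_le// ltnS leqNgt; apply/negP => /xy /eqP.
by rewrite (negPf kP).
Qed.

Lemma dist_nagree n x y : ~ agree n x y -> a n <= d x y.
Proof.
move=> xy; have /first_diff[k kxy kP] : x <> y by move=> e; apply: xy; rewrite e.
rewrite (dist_seqE kxy kP) decr_seq_le// ltnNge; apply/negP => nk; apply: xy.
exact: agree_le kxy.
Qed.

Lemma dist_shift n x y : (forall k, (n <= k)%N -> 2 * a k.+1 <= a k) ->
  (0 < n)%N -> agree n x y -> 2 * d x y <= d (shift x) (shift y).
Proof.
move=> ha n0 xy; have [->|/eqP/first_diff[k kxy kP]] := eqVneq x y.
  by rewrite !dist_seqxx mulr0.
have nk : (n <= k)%N.
  by rewrite leqNgt; apply/negP => /xy /eqP; rewrite (negPf kP).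
case: k kxy kP nk => [|k] kxy kP nk; first by move: n0; rewrite ltnNge nk.
rewrite (dist_seqE kxy kP) (@dist_seqE k); first exact: ha.
- exact: agree_shift.
- exact: kP.
Qed.

End Metric.

Section NearOrbit.
Context {R : realType}.
Variables (m : nat) (w : cantor_space) (p : nat).
Hypothesis sw : simple_cycle m w p.

Definition near_orbit n x := exists j, agree n x (iter j shift w).

Definition orbit_pt n x := iter (xget 0%N [set j | agree n x (iter j shift w)]) shift w.

Definition off_orbit n x : R := (~~ `[< near_orbit n x >])%:R.

Lemma orbit_ptP n x : near_orbit n x -> agree n x (orbit_pt n x).
Proof. by move=> [j xj]; rewrite /orbit_pt; case: xgetP => [i _|/(_ j)/(_ xj)]. Qed.

Lemma orbit_ptE n x j : (m <= n)%N -> agree n x (iter j shift w) ->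
  orbit_pt n x = iter j shift w.
Proof.
move=> mn xj; apply: (simple_cycle_eq sw); apply: (agree_le mn).
have /orbit_ptP h : near_orbit n x by exists j.
exact: agree_trans (agree_sym h) xj.
Qed.

(** The successor of an edge of the cycle leaves the vertex at which this edge
    ends, and a simple cycle passes through it only once. *)
Lemma orbit_pt_shift x : near_orbit m.+1 x -> near_orbit m.+1 (shift x) ->
  orbit_pt m.+1 (shift x) = shift (orbit_pt m.+1 x).
Proof.
move=> /orbit_ptP + [i xi].
rewrite (orbit_ptE _ xi)// /orbit_pt; set j := xget _ _ => xj.
rewrite -[shift _]/(iter j.+1 shift w); apply: (simple_cycle_eq sw).
exact: agree_trans (agree_sym (agree_le (leqnSn _) xi)) (agree_shift xj).
Qed.

(** By [orbit_pt_shift] the first edge decides which point of the cycle is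
    followed, and every later one has to follow the same point. *)
Lemma near_orbit_all c : (forall i, near_orbit m.+1 (iter i shift c)) ->
  exists j, c = iter j shift w.
Proof.
move=> h; set j := xget 0%N [set j | agree m.+1 c (iter j shift w)].
exists j; have e i : orbit_pt m.+1 (iter i shift c) = iter (i + j) shift w.
  elim: i => // i IH.
  by rewrite iterS orbit_pt_shift ?IH//; exact: (h i.+1).
apply/funext => i; have := orbit_ptP (h i); rewrite e => /(_ 0%N isT).
by rewrite !iter_shiftE !addn0 addnC.
Qed.

End NearOrbit.

(** * The locking estimate *)

Section Locking.
Context {R : realType} (a : decr_seq R).
Local Notation d := (dist_seq a).
Variables (m : nat) (w : cantor_space) (p : nat) (phi G : cantor_space -> R).
Variables (delta kappa A : R).
Local Notation n := m.+1.
Hypothesis lphi : local_fun n phi.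
Hypothesis sw : simple_cycle m w p.
Hypothesis gap : forall c q, simple_cycle m c q ->
  (exists i, ~ near_orbit w n (iter i shift c)) ->
  birkhoff phi q c / q%:R <= birkhoff phi p w / p%:R - delta.
Hypothesis Gphi : forall x, `|G x - phi x| <= kappa.
Hypothesis A0 : 0 <= A.
Hypothesis GA : forall x y, `|G x - G y| <= A * d x y.
Hypothesis Ak : A * a n.+1 <= kappa.
Hypothesis ha : forall k, (n <= k)%N -> 2 * a k.+1 <= a k.
Hypothesis kd : 5 * kappa <= delta.

Let beta := birkhoff G p w / p%:R.
Let chi := @off_orbit R w n.
Let pt := orbit_pt w n.
(** Taking the values of [G] itself at the points of the orbit makes the
    difference with [G] vanish there. *)
Let phis x := if `[< near_orbit w n x >] then G (pt x) else phi x.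
(** The bound on the error still to come while the orbit of [x] follows the
    cycle, capped so that entering and leaving cost a multiple of [kappa]. *)
Let V x := if `[< near_orbit w n x >] then A * d x (pt x) else 2 * (A * a n.+1).

Let phis_near x y : agree n x y ->
  (near_orbit w n x -> near_orbit w n y) * (near_orbit w n x -> pt x = pt y).
Proof.
move=> xy; split=> [[j xj]|/orbit_ptP xj].
  by exists j; apply: agree_trans xj; exact: agree_sym.
by apply/esym/(orbit_ptE sw) => //; apply: agree_trans xj; exact: agree_sym.
Qed.

Let phis_local : local_fun n phis.
Proof.
move=> x y xy; rewrite /phis; have yx := agree_sym xy.
case: asboolP => hx; case: asboolP => hy.
- by rewrite (phis_near xy).2.
- by case: hy; exact: (phis_near xy).1.
- by case: hx; exact: (phis_near yx).1.
- exact: lphi.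
Qed.

Let chi_local : local_fun n chi.
Proof.
move=> x y xy; rewrite /chi /off_orbit; congr (~~ _)%:R; apply/asbool_equiv_eq.
by split; [exact: (phis_near xy).1 | exact: (phis_near (agree_sym xy)).1].
Qed.

Let chi_01 x : 0 <= chi x <= 1.
Proof. by rewrite /chi /off_orbit; case: (~~ _); rewrite lexx ler01. Qed.

Let kappa_ge0 : 0 <= kappa. Proof. exact: le_trans (Gphi w). Qed.

Let phis_phi x : `|phis x - phi x| <= kappa.
Proof.
rewrite /phis; case: asboolP => [/orbit_ptP xj|_]; last by rewrite subrr normr0.
by rewrite (lphi xj).
Qed.

Let phis_orbit k j : birkhoff phis k (iter j shift w) = birkhoff G k (iter j shift w).
Proof.
apply: eq_bigr => i _; rewrite iter_shift_add /phis.
case: asboolP => [_|[]]; last by exists (i + j)%N.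
by rewrite /pt (orbit_ptE sw _ (@agreexx n _)).
Qed.

Let p0 : 0 < p%:R :> R.
Proof. by have [? _ _] := sw; rewrite ltr0n. Qed.

Let beta_ge : birkhoff phi p w / p%:R - kappa <= beta.
Proof.
rewrite /beta -(phis_orbit p 0) /= lerBlDr -[kappa](mulfK (lt0r_neq0 p0)) -mulrDl.
rewrite ler_pM2r ?invr_gt0// mulrC -(birkhoff_cst _ _ w) -birkhoffD; apply: ler_birkhoff => x.
have := phis_phi x; rewrite distrC => /ler_normlP[]; lra.
Qed.

(** Here the gap is spent: [kappa] for passing from [phi] to [phis] along [c],
    and [kappa] again for passing from the mean of [phi] on the cycle to [beta]. *)
Let cycle_le0 c q : simple_cycle m c q ->
  birkhoff (fun x => phis x + ((delta - 2 * kappa) * chi x + - beta)) q c <= 0.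
Proof.
move=> sc; rewrite !birkhoffD birkhoffZ birkhoff_cst.
have q0 : 0 < q%:R :> R by have [? _ _] := sc; rewrite ltr0n.
have [h|/existsNP far] := pselect (forall i, near_orbit w n (iter i shift c)).
  have [j cj] := near_orbit_all sw h.
  have <- := simple_cycle_period sw sc cj.
  rewrite [X in _ * X + _](_ : _ = 0); last first.
    by apply: big1 => i _; rewrite /chi /off_orbit; case: asboolP => // -[].
  rewrite cj phis_orbit (birkhoff_rot _ _ ) /beta; last by have [] := sw.
  by rewrite mulrN mulrCA mulfV ?lt0r_neq0// mulr1 mulr0 add0r subrr.
have chi_le : birkhoff chi q c <= q%:R.
  rewrite -[leRHS]mulr1 -(birkhoff_cst _ _ c); apply: ler_birkhoff => x.
  by have /andP[] := chi_01 x.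
have phis_le : birkhoff phis q c <= birkhoff phi q c + q%:R * kappa.
  rewrite -(birkhoff_cst _ _ c) -birkhoffD; apply: ler_birkhoff => x.
  by have /ler_normlP[] := phis_phi x; lra.
have := gap sc far; rewrite ler_pdivrMr// => h.
have dk : 0 <= delta - 2 * kappa by move: kd kappa_ge0; lra.
have := ler_wpM2l dk chi_le.
have : q%:R * (birkhoff phi p w / p%:R - kappa) <= q%:R * beta by rewrite ler_pM2l.
lra.
Qed.

Let V_ge0 x : 0 <= V x.
Proof.
rewrite /V; case: asboolP => _; rewrite !mulr_ge0// ?dist_seq_ge0//.
exact/ltW/decr_seq_gt0.
Qed.

Let V_le x : V x <= 2 * kappa.
Proof.
rewrite /V; case: asboolP => [/orbit_ptP h|_]; last by rewrite ler_pM2l.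
have := ler_wpM2l A0 (dist_agree a h); move: Ak kappa_ge0; lra.
Qed.

(** On an edge of the cycle the error of replacing [x] by the point of the
    orbit in the same cylinder is paid by the growth of the distance between
    them, which at least doubles under the shift. *)
Let tail_le x : G x - phis x <= (V (shift x) - V x) + 3 * kappa * chi x.
Proof.
rewrite /phis {2}/V /chi /off_orbit; case: asboolP => [h|_] /=; last first.
  rewrite mulr1; have /ler_normlP[_] := Gphi x; have := V_ge0 (shift x).
  by move: Ak; lra.
rewrite mulr0 addr0; apply: le_trans (ler_norm _) _.
apply: le_trans (GA _ _) _; rewrite lerBrDr -mulr2n -mulr_natl /V.
case: asboolP => h'.
  rewrite /pt (orbit_pt_shift sw h h') mulrCA ler_wpM2l//.
  exact: (dist_shift (n := n)) (orbit_ptP h).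
by rewrite ler_pM2l// ler_wpM2l// dist_agree//; exact: orbit_ptP.
Qed.

(** The finite-range function [phis] agrees with [G] on the orbit and keeps a
    gap of [delta - 2 * kappa], so by [birkhoff_le_of_cycles] its sums lose that
    much for each visit off the cycle. By [tail_le] the sums of [G - phis] are a
    bounded telescoping term plus at most [3 * kappa] for each such visit. *)
Lemma locking : exists2 C, 0 <= C & forall k x,
  birkhoff G k x + (delta - 5 * kappa) * birkhoff chi k x <= k%:R * beta + C.
Proof.
pose psi x := phis x + ((delta - 2 * kappa) * chi x + - beta).
have lpsi : local_fun n psi.
  by move=> x y xy; rewrite /psi (phis_local xy) (chi_local xy).
pose D := `|G w + A * a 0%N + kappa + (delta - 2 * kappa) - beta|.
have psiD x : psi x <= D.
  apply: le_trans (ler_norm _).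
  have Gle y : G y <= G w + A * a 0%N.
    have /ler_normlP[_] := GA y w; have := ler_wpM2l A0 (dist_seq_le a y w); lra.
  have phisle : phis x <= G w + A * a 0%N + kappa.
    rewrite /phis; case: asboolP => _.
      by have := Gle (pt x); move: kappa_ge0; lra.
    by have := Gle x; have /ler_normlP[+ _] := Gphi x; lra.
  have : (delta - 2 * kappa) * chi x <= (delta - 2 * kappa) * 1.
    rewrite ler_wpM2l//; first by move: kd kappa_ge0; lra.
    by have /andP[] := chi_01 x.
  rewrite /psi; lra.
have key := birkhoff_le_of_cycles lpsi (normr_ge0 _) psiD cycle_le0.
exists ((2 ^ m)%:R * D + 2 * kappa).
  by apply: addr_ge0; apply: mulr_ge0 => //; exact: normr_ge0.
move=> k x.
have tel : birkhoff (fun x => V (shift x) - V x) k x = V (iter k shift x) - V x.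
  elim: k => [|k IH]; first by rewrite /birkhoff big_ord0 subrr.
  by rewrite -addn1 birkhoff_cat IH /birkhoff big_ord1 /= addn1 /=; lra.
have := ler_birkhoff k x tail_le.
rewrite [leRHS]birkhoffD tel birkhoffZ [leLHS]birkhoffD.
rewrite (_ : birkhoff (fun x => - phis x) k x = - birkhoff phis k x); last first.
  by rewrite /birkhoff sumrN.
have := key k x; rewrite /psi !birkhoffD !birkhoffZ birkhoff_cst.
have := V_le (iter k shift x); have := V_ge0 x; rewrite /D; lra.
Qed.

End Locking.

(** * Optimal cycles and their isolation *)

Section Isolation.
Context {R : realType}.
Variable m : nat.
Implicit Types phi : cantor_space -> R.

Definition mean phi p (w : cantor_space) : R := birkhoff phi p w / p%:R.

Definition optimal_cycle phi w p := simple_cycle m w p /\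
  forall c q, simple_cycle m c q -> mean phi q c <= mean phi p w.

Lemma simple_cycle_fixpoint : simple_cycle m (fun=> false) 1.
Proof.
split=> //.
by move=> i j ij; rewrite ltnS leqn0 => /eqP j0; move: ij; rewrite j0.
Qed.

(** There are finitely many simple cycles, as each is read off its first
    [2 ^ m] letters and its length. *)
Lemma optimal_cycle_exists phi : exists w p, optimal_cycle phi w p.
Proof.
pose T := ((2 ^ m).-tuple bool * 'I_(2 ^ m).+1)%type.
pose dec (t : T) : cantor_space := fun i => nth false t.1 (i %% t.2).
pose P (t : T) := `[< simple_cycle m (dec t) t.2 >].
have enc w p : simple_cycle m w p ->
    exists2 t : T, P t & dec t = w /\ t.2 = p :> nat.
  move=> sw; have pm := simple_cycle_le sw; have [p0 pw _] := sw.
  have decE : dec (word (2 ^ m) w, inord p) = w.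
    apply/funext => i; rewrite /dec /= inordK ?ltnS//.
    have ip : (i %% p < 2 ^ m)%N by rewrite (leq_trans _ pm)// ltn_mod.
    rewrite (nth_mktuple _ _ (Ordinal ip)) /=.
    have := congr1 (fun z : cantor_space => z 0%N) (iter_shift_mod i pw).
    by rewrite !iter_shiftE !addn0.
  exists (word (2 ^ m) w, inord p); last by rewrite /= inordK// ltnS.
  by apply/asboolP; rewrite decE /= inordK// ltnS.
have [t0 Pt0 _] := enc _ _ simple_cycle_fixpoint.
have [t /asboolP Pt tmax] := arg_maxP (fun t : T => mean phi t.2 (dec t)) Pt0.
exists (dec t), t.2; split=> // c q /enc[s Ps [<- <-]].
exact: tmax.
Qed.

(** A tie, up to [delta], between the best cycles that avoid [e] and the best
    ones through [e]. *)
Definition tied_at phi delta (e : m.+1.-tuple bool) := exists u q w p,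
  [/\ simple_cycle m u q, (exists i, word m.+1 (iter i shift u) = e),
      optimal_cycle phi w p, (forall i, word m.+1 (iter i shift w) <> e) &
      mean phi p w - delta < mean phi q u].

(** A cycle that leaves the optimal one has an edge that the optimal one avoids,
    and the absence of a tie at this edge is a gap between them. *)
Lemma untied_gap phi delta w p : optimal_cycle phi w p ->
  (forall e, ~ tied_at phi delta e) ->
  forall c q, simple_cycle m c q ->
    (exists i, ~ near_orbit w m.+1 (iter i shift c)) ->
    mean phi q c <= mean phi p w - delta.
Proof.
move=> ow unt c q sc [i far]; rewrite leNgt; apply/negP => lt.
apply: (unt (word m.+1 (iter i shift c))); exists c, q, w, p; split=> //.
  by exists i.
by move=> j /wordP h; apply: far; exists j; exact: agree_sym.
Qed.

(** The isolation principle. Raising the weight of [e] alone lifts every cycle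
    through [e] by at least [h / 2 ^ m], since a simple cycle has length at most
    [2 ^ m], and leaves those that avoid [e] unchanged; so if the former come
    close to the latter before, they overtake them after. *)
Lemma tied_at_isolated phi psi delta h e :
  (forall x, psi x = phi x + h * (word m.+1 x == e)%:R) ->
  0 <= delta -> delta * (2 ^ m)%:R <= h ->
  tied_at phi delta e -> tied_at psi delta e -> False.
Proof.
move=> psiE d0 dh [u [q [w [p [su ue [sw wmax] we lt]]]]].
move=> [_ [_ [w' [p' [_ _ [sw' wmax'] we' _]]]]].
have h0 : 0 <= h by apply: le_trans dh; rewrite mulr_ge0.
have same : mean psi p' w' = mean phi p' w'.
  congr (_ / _); apply: eq_bigr => i _; rewrite psiE.
  by case: eqP => [/we'//|_]; rewrite mulr0 addr0.
have [q0 qu _] := su.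
have lift : mean phi q u + delta <= mean psi q u.
  have q0' : 0 < q%:R :> R by rewrite ltr0n.
  rewrite /mean -[delta](mulfK (lt0r_neq0 q0')) -mulrDl ler_pM2r ?invr_gt0//.
  rewrite /birkhoff (eq_bigr _ (fun i _ => psiE _)) big_split/= lerD2l.
  apply: (@le_trans _ _ h).
    apply: le_trans dh; rewrite ler_wpM2l// ler_nat.
    exact: simple_cycle_le su.
  have [i ei] := ue; pose j := Ordinal (ltn_pmod i q0).
  rewrite (bigD1 j)//= -(iter_shift_mod i qu) ei eqxx mulr1 lerDl sumr_ge0//.
  by move=> k _; rewrite mulr_ge0.
have := wmax' _ _ su; have := wmax _ _ sw'; rewrite same; lra.
Qed.

End Isolation.

(** * Integrals against invariant measures *)

Lemma open_agree n x : open [set y | agree n x y].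
Proof.
elim: n => [|n IH].
  by rewrite (_ : [set y | _] = setT); [exact: openT | apply/seteqP; split].
have -> : [set y | agree n.+1 x y] =
    [set y | agree n x y] `&` (fun y : cantor_space => y n) @^-1` [set x n].
  apply/seteqP; split => y /=.
    by move=> h; split; [exact: agree_le h | rewrite h].
  by move=> [h e] i; rewrite ltnS leq_eqVlt => /predU1P[->//|/h].
apply: openI => //; apply: open_comp; last exact: discrete_open.
by move=> y _; exact: (@proj_continuous nat (fun=> bool) n y).
Qed.

Lemma agree_nbhs n (x : cantor_space) : nbhs x [set y | agree n x y].
Proof. by apply: open_nbhs_nbhs; split; [exact: open_agree | move=> i]. Qed.

Lemma open_local (L : nat) (A : set cantor_space) :
  (forall x y, agree L x y -> A x -> A y) -> open A.
Proof.
move=> lA; rewrite openE => x Ax; apply: filterS (agree_nbhs L x).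
by move=> y /lA; apply.
Qed.

(** The cylinders about [x] form a filter base that converges to [x]
    coordinatewise, hence in the product topology. *)
Lemma nbhs_agree (x : cantor_space) (U : set cantor_space) :
  nbhs x U -> exists n, [set y | agree n x y] `<=` U.
Proof.
pose F := filter_from [set: nat] (fun n => [set y : cantor_space | agree n x y]).
have FF : Filter F.
  apply: filter_from_filter; first by exists 0%N.
  move=> i j _ _; exists (maxn i j) => // y /= h.
  by split; apply: agree_le h; rewrite ?leq_maxl ?leq_maxr.
have : F --> x.
  apply/cvg_sup => N V [W] [[Z] oZ <-] ZfN ZV.
  by exists N.+1 => // y /= h; apply: ZV => /=; rewrite -h.
by move=> /[apply] -[n _ nU]; exists n.
Qed.

Lemma shift_continuous : continuous shift.
Proof.
move=> x U /nbhs_agree[n nU].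
suff : nbhs x (shift @^-1` U) by [].
apply: (@filterS _ _ _ [set y | agree n.+1 x y]).
  by move=> y /= h; exact: (nU (shift y) (agree_shift h)).
exact: agree_nbhs.
Qed.

Section Integrals.
Context {R : realType}.
Local Notation Prob := (probability (borel cantor_space) R).
Implicit Types f g : cantor_space -> R.

Lemma borel_continuous f : continuous f ->
  measurable_fun [set: borel cantor_space] f.
Proof.
move=> cf; apply: (measurability _ (RGenOpens.measurableE R)).
move=> _ [_ [x [y ->]] <-]; rewrite setTI; apply: sub_sigma_algebra.
by apply: open_comp; [move=> z _; exact: cf | exact: interval_open].
Qed.

Lemma measurable_shift : measurable_fun [set: borel cantor_space] (shift : borel cantor_space -> borel cantor_space).
Proof.
apply: (@measurability _ _ _ (borel cantor_space) _ _ (@open cantor_space) erefl) => _ [U oU <-]; rewrite setTI.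
apply: sub_sigma_algebra; apply: open_comp => // x _; exact: shift_continuous.
Qed.

Definition bounded_measurable f :=
  measurable_fun [set: borel cantor_space] f /\ exists M, forall x, `|f x| <= M.

Lemma bounded_measurableD f g : bounded_measurable f -> bounded_measurable g ->
  bounded_measurable (fun x => f x + g x).
Proof.
move=> [mf [M fM]] [mg [N gN]]; split; first exact: measurable_funD.
by exists (M + N) => x; apply: le_trans (ler_normD _ _) _; rewrite lerD.
Qed.

Lemma bounded_measurableZ c f : bounded_measurable f ->
  bounded_measurable (fun x => c * f x).
Proof.
move=> [mf [M fM]]; split; first exact: measurable_funM.
by exists (`|c| * M) => x; rewrite normrM ler_wpM2l.
Qed.

Lemma bounded_measurable_shift f i : bounded_measurable f ->
  bounded_measurable (fun x => f (iter i shift x)).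
Proof.
move=> [mf [M fM]]; split; last by exists M => x.
elim: i f mf {fM} => // i IH f mf.
have -> : (fun x => f (iter i.+1 shift x)) = (fun x => (f \o shift) (iter i shift x)) by [].
by apply: (IH (f \o shift)); exact: (measurableT_comp mf measurable_shift).
Qed.

Lemma bounded_measurable_cst c : bounded_measurable (fun=> c).
Proof. by split; [exact: measurable_cst | exists `|c|]. Qed.

Lemma bounded_measurable_birkhoff f k : bounded_measurable f ->
  bounded_measurable (birkhoff f k).
Proof.
move=> bf; elim: k => [|k IH].
  rewrite (_ : birkhoff f 0 = fun=> 0); first exact: bounded_measurable_cst.
  by apply/funext => x; rewrite /birkhoff big_ord0.
rewrite (_ : birkhoff f k.+1 = fun x => birkhoff f k x + f (iter k shift x)).
  by apply: bounded_measurableD => //; exact: bounded_measurable_shift.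
by apply/funext => x; rewrite /birkhoff big_ord_recr.
Qed.

Variable nu : Prob.
Local Notation I f := (\int[nu]_x f x).

Lemma bounded_measurable_integrable f : bounded_measurable f ->
  nu.-integrable setT (EFin \o f).
Proof.
move=> [mf [M fM]]; apply: measurable_bounded_integrable => //.
  by rewrite (le_lt_trans (probability_le1 nu _)) ?ltry.
exists `|M|; split; first exact: normr_real.
by move=> y My x _ /=; apply: le_trans (fM x) _; apply: le_trans (ler_norm M) (ltW My).
Qed.

Lemma integral_fine f : bounded_measurable f ->
  (\int[nu]_x (f x)%:E = (I f)%:E)%E.
Proof.
by move=> bf; rewrite fineK//; apply: integrable_fin_num => //; exact: bounded_measurable_integrable.
Qed.

Lemma bounded_integralD f g : bounded_measurable f -> bounded_measurable g ->
  I (fun x => f x + g x) = I f + I g.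
Proof. by move=> bf bg; rewrite RintegralD//; exact: bounded_measurable_integrable. Qed.

Lemma bounded_integralZ c f : bounded_measurable f -> I (fun x => c * f x) = c * I f.
Proof. by move=> bf; rewrite RintegralZl//; exact: bounded_measurable_integrable. Qed.

Lemma prob_integral_cst c : I (fun=> c) = c.
Proof.
rewrite Rintegral_cst// -[RHS]mulr1; congr (_ * _).
by rewrite -[RHS]/(fine 1%E); congr fine; exact: probability_setT.
Qed.

Lemma le_bounded_integral f g : bounded_measurable f -> bounded_measurable g ->
  (forall x, f x <= g x) -> I f <= I g.
Proof. by move=> bf bg fg; apply: le_Rintegral => //; exact: bounded_measurable_integrable. Qed.

Lemma ae_eq_bounded_integral f g (N : set (borel cantor_space)) :
  bounded_measurable f -> bounded_measurable g ->
  measurable N -> nu N = 0%E -> (forall x, ~ N x -> f x = g x) -> I f = I g.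
Proof.
move=> [mf _] [mg _] mN N0 fg; congr fine; apply: ae_eq_integral => //.
- exact/measurable_EFinP.
- exact/measurable_EFinP.
- exists N; split=> // x /= h; apply: contrapT => Nx; apply: h => _.
  by rewrite fg.
Qed.

Hypothesis inv : shift_invariant nu.

Lemma invariant_integral_shift f : bounded_measurable f ->
  I (fun x => f (shift x)) = I f.
Proof.
move=> bf; have [mf _] := bf.
have bfs := bounded_measurable_shift 1 bf.
congr fine.
transitivity (\int[pushforward nu (shift : borel cantor_space -> borel cantor_space)]_x (f x)%:E)%E.
  rewrite (integral_pushforward measurable_shift)//=.
  - by apply/measurable_EFinP.
  - rewrite preimage_setT; exact: (bounded_measurable_integrable bfs).
apply: eq_measure_integral => [|mS A mA _]; [exact: measurable_shift|exact: (inv mA)].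
Qed.

Lemma invariant_integral_birkhoff f k : bounded_measurable f ->
  I (birkhoff f k) = k%:R * I f.
Proof.
move=> bf; elim: k => [|k IH].
  rewrite mul0r -[RHS](prob_integral_cst 0); apply: eq_Rintegral => x _.
  by rewrite /birkhoff big_ord0.
rewrite (_ : I (birkhoff f k.+1) = I (fun x => birkhoff f k x + f (iter k shift x))); last first.
  by apply: eq_Rintegral => x _; rewrite /birkhoff big_ord_recr.
rewrite bounded_integralD; [|exact: bounded_measurable_birkhoff|exact: bounded_measurable_shift].
rewrite IH -natr1 mulrDl mul1r; congr (_ + _).
elim: k {IH} => // k IH; rewrite -IH.
rewrite -(invariant_integral_shift (bounded_measurable_shift k bf)).
by apply: eq_Rintegral => x _; rewrite -iterSr.
Qed.

(** The integral of a Birkhoff sum is [k] times the mean, so that the bounded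
    error disappears after division by [k]. *)
Lemma invariant_integral_le f b C : bounded_measurable f ->
  (forall k x, birkhoff f k x <= k%:R * b + C) -> I f <= b.
Proof.
move=> bf fb; rewrite leNgt; apply/negP => bI.
have d0 : 0 < I f - b by rewrite subr_gt0.
have [k kC] : exists k, C < k%:R * (I f - b).
  exists (Num.truncn (`|C| / (I f - b))).+1; rewrite -ltr_pdivrMr//.
  apply: le_lt_trans (truncnS_gt _).
  by rewrite ler_pM2r ?invr_gt0// ler_norm.
have : I (birkhoff f k) <= I (fun=> k%:R * b + C).
  apply: le_bounded_integral => //; first exact: bounded_measurable_birkhoff.
  exact: bounded_measurable_cst.
rewrite prob_integral_cst invariant_integral_birkhoff// => h.
by move: kC; rewrite mulrBr; lra.
Qed.

End Integrals.

(** * The measure carried by a periodic orbit *)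

Lemma mnormalizeE d (T : measurableType d) (R : realType)
  (mu : {measure set T -> \bar R}) (P : probability T R) (r : R) (A : set T) :
  0 < r -> mu setT = r%:E -> mnormalize mu P A = (mu A * (r^-1)%:E)%E.
Proof. by move=> r0 muT; rewrite /mnormalize muT eqe gt_eqF. Qed.

Section OrbitMeasure.
Context {R : realType}.
Local Notation Prob := (probability (borel cantor_space) R).
Variables (m : nat) (w : cantor_space) (p : nat).
Hypothesis sw : simple_cycle m w p.

Let pw : iter p shift w = w. Proof. by have [] := sw. Qed.
Let p0 : 0 < p%:R :> R. Proof. by have [? _ _] := sw; rewrite ltr0n. Qed.

Definition orbit_set : set (borel cantor_space) := [set iter k shift w | k in [set: nat]].
Let far : set (borel cantor_space) := [set x | ~ near_orbit w m.+1 x].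

Lemma open_far : open (far : set cantor_space).
Proof.
apply: (@open_local m.+1) => x y xy xfar [j yj]; apply: xfar; exists j.
exact: agree_trans xy yj.
Qed.

Let mfar : measurable far.
Proof. by apply: sub_sigma_algebra; exact: open_far. Qed.

Lemma off_orbitE : off_orbit w m.+1 = \1_far :> (cantor_space -> R).
Proof.
apply/funext => x; rewrite indicE /off_orbit; congr (nat_of_bool _)%:R.
apply/idP/idP; first by move=> /asboolPn h; apply/mem_set.
by move=> /set_mem h; apply/asboolPn.
Qed.

Lemma orbit_setC : ~` orbit_set = \bigcup_i (iter i shift) @^-1` far.
Proof.
apply/seteqP; split => x.
  move=> xO; apply: contrapT => h; apply: xO.
  have [j ->] : exists j, x = iter j shift w.
    apply: (near_orbit_all sw) => i; apply: contrapT => hi.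
    by apply: h; exists i.
  by exists j.
move=> [i _ /= hi] [k _ xk]; apply: hi; exists (i + k)%N.
by rewrite -xk iter_shift_add.
Qed.

Let measurable_iter_far i : measurable (iter i shift @^-1` far : set (borel cantor_space)).
Proof.
elim: i => [|i IH]; first exact: mfar.
rewrite (_ : _ @^-1` _ = shift @^-1` (iter i shift @^-1` far)); last first.
  by apply/seteqP; split => x; rewrite /preimage /= -iterSr.
by rewrite -[X in measurable X]setTI; exact: measurable_shift.
Qed.

Lemma measurable_orbit_set : measurable orbit_set.
Proof.
rewrite -[orbit_set]setCK orbit_setC; apply: measurableC.
by apply: bigcupT_measurable => i; exact: measurable_iter_far.
Qed.

(** On the orbit every Birkhoff sum over a full period is the same, so an
    invariant measure carried by the orbit integrates to the mean. *)
Lemma integral_on_orbit (nu : Prob) f : shift_invariant nu ->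
  nu (~` orbit_set) = 0%E -> bounded_measurable f ->
  \int[nu]_x f x = mean f p w.
Proof.
move=> inv nuO bf; have := invariant_integral_birkhoff inv p bf.
rewrite (ae_eq_bounded_integral (bounded_measurable_birkhoff p bf)
  (bounded_measurable_cst (birkhoff f p w)) (measurableC measurable_orbit_set) nuO).
  by rewrite prob_integral_cst /mean => ->; rewrite mulrC mulKf// lt0r_neq0.
by move=> x /contrapT[j _ <-]; exact: birkhoff_rot.
Qed.

Definition orbit_prob : Prob :=
  mnormalize (msum (fun i => \d_(iter i shift w : borel cantor_space)) p)
             (\d_(w : borel cantor_space)).

Lemma orbit_probE (A : set (borel cantor_space)) :
  orbit_prob A = (mean (\1_A : cantor_space -> R) p w)%:E.
Proof.
have msumE (B : set (borel cantor_space)) : msum (fun i => \d_(iter i shift w : borel cantor_space)) p B =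
    (birkhoff (\1_B : cantor_space -> R) p w)%:E.
  by rewrite /msum /birkhoff -sumEFin.
have msumT : msum (fun i => \d_(iter i shift w : borel cantor_space)) p [set: borel cantor_space] = (p%:R : R)%:E.
  apply: (etrans (msumE _)); congr EFin.
  rewrite /birkhoff (eq_bigr (fun=> 1)) ?sumr_const ?card_ord// => i _.
  by rewrite indicE in_setT.
apply: (etrans (mnormalizeE _ _ p0 msumT)).
by rewrite /mean EFinM; congr (_ * _)%E; exact: msumE.
Qed.

Lemma orbit_prob_invariant : shift_invariant orbit_prob.
Proof.
move=> A mA; rewrite !orbit_probE; congr (_ / _)%:E.
by rewrite -(birkhoff_rot (\1_A) 1 pw); apply: eq_bigr => i _; rewrite /= -iterSr.
Qed.

Lemma orbit_prob_orbit : orbit_prob orbit_set = 1%E.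
Proof.
rewrite orbit_probE /mean /birkhoff (eq_bigr (fun=> 1)).
  by rewrite sumr_const card_ord mulfV// lt0r_neq0.
by move=> i _; rewrite indicE mem_set//; exists (val i).
Qed.

Lemma orbit_prob_setC : orbit_prob (~` orbit_set) = 0%E.
Proof.
rewrite probability_setC; last exact: measurable_orbit_set.
by rewrite orbit_prob_orbit subee.
Qed.

Lemma orbit_prob_periodic : on_periodic_orbit orbit_prob.
Proof.
by exists w, p; split; [have [] := sw | exact: pw | exact: orbit_prob_orbit].
Qed.

(** A maximizing measure gives no mass to the points off the cycle, by the loss
    term, nor by invariance to the points whose orbit ever leaves it. So it lives
    on the orbit, where [integral_on_orbit] determines it. *)
Lemma orbit_prob_unique (G : cantor_space -> R) s C : bounded_measurable G ->
  0 < s ->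
  (forall k x, birkhoff G k x + s * birkhoff (off_orbit w m.+1) k x <=
    k%:R * mean G p w + C) ->
  unique_maximizing G orbit_prob.
Proof.
move=> bG s0 hG.
have bchi : bounded_measurable (off_orbit w m.+1 : cantor_space -> R).
  rewrite off_orbitE; split; first exact: measurable_indic.
  by exists 1 => x; rewrite indicE; case: (_ \in _); rewrite ?normr1 ?normr0.
have bound (nu : Prob) : shift_invariant nu ->
    \int[nu]_x G x + s * \int[nu]_x off_orbit w m.+1 x <= mean G p w.
  move=> inv; have bs := bounded_measurableZ s bchi.
  rewrite -(bounded_integralZ nu s bchi) -(bounded_integralD nu bG bs).
  apply: (invariant_integral_le (C := C) inv); first exact: bounded_measurableD.
  by move=> k x; rewrite birkhoffD birkhoffZ.
have chi_ge0 (nu : Prob) : 0 <= \int[nu]_x (off_orbit w m.+1 x : R).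
  by apply: Rintegral_ge0 => x _; rewrite /off_orbit.
have orb := integral_on_orbit orbit_prob_invariant orbit_prob_setC bG.
split.
  split=> [|nu inv]; first exact: orbit_prob_invariant.
  rewrite !integral_fine// lee_fin orb; apply: le_trans (bound _ inv).
  by rewrite lerDl mulr_ge0// ltW.
move=> nu [inv numax] A mA.
have chi0 : \int[nu]_x (off_orbit w m.+1 x : R) = 0.
  apply/eqP; rewrite eq_le chi_ge0 andbT.
  have := numax _ orbit_prob_invariant; rewrite !integral_fine// lee_fin orb.
  have := bound _ inv; rewrite -(pmulr_rle0 _ s0); lra.
have nufar : nu far = 0%E.
  have : (\int[nu]_x (off_orbit w m.+1 x : R)%:E = 0)%E.
    by rewrite integral_fine// chi0.
  by rewrite off_orbitE integral_indic// setIT.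
have nuO : nu (~` orbit_set) = 0%E.
  have mO := measurableC measurable_orbit_set.
  apply: (negligibleP nu mO).1; rewrite orbit_setC; apply: negligible_bigcup => i.
  apply: (negligibleP nu (measurable_iter_far i)).2.
  elim: i => // i <-; rewrite -[RHS]inv; last exact: measurable_iter_far.
  by congr (nu _); apply/seteqP; split => x; rewrite /preimage /= -iterSr.
have := integral_on_orbit inv nuO (f := \1_A).
rewrite orbit_probE => <-; last first.
  split; first exact: measurable_indic.
  by exists 1 => x; rewrite indicE; case: (_ \in _); rewrite ?normr1 ?normr0.
rewrite /Rintegral integral_indic// setIT fineK// fin_num_measure//.
Qed.

End OrbitMeasure.

(** * Fair coins *)

Lemma image_prob d d' (T : measurableType d) (T' : measurableType d')
  (R : realType) (P : probability T R) (f : T -> T') :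
  measurable_fun [set: T] f ->
  exists Q : probability T' R, forall A, Q A = P (f @^-1` A).
Proof.
move=> mf; pose X : {mfun T >-> T'} := HB.pack f (isMeasurableFun.Build _ _ _ _ _ mf).
by exists (distribution P X).
Qed.

Lemma prob_bigU_le d (T : measurableType d) (R : realType) (P : probability T R)
  (I : Type) (s : seq I) (F : I -> set T) (r : R) :
  (forall i, measurable (F i)) -> (forall i, (P (F i) <= r%:E)%E) ->
  (P (\big[setU/set0]_(i <- s) F i) <= ((size s)%:R * r)%:E)%E.
Proof.
move=> mF Fr; elim: s => [|i s IH]; first by rewrite big_nil measure0 mul0r.
rewrite big_cons /= -natr1 mulrDl mul1r addrC EFinD.
apply: le_trans (leeD (Fr i) IH); apply: measureU2 => //.
exact: bigsetU_measurable.
Qed.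

Section CoinMeasure.
Context {R : realType}.

Let half_open (L k : nat) : set R :=
  `[k%:R * (2 ^+ L)^-1, k.+1%:R * (2 ^+ L)^-1[%classic.

Let in_half_open L k x : half_open L k x <-> k%:R <= x * 2 ^+ L < k.+1%:R.
Proof.
rewrite /half_open /= in_itv /= ler_pdivrMr ?exprn_gt0// ltr_pdivlMr ?exprn_gt0//.
Qed.

Definition binary_digits (x : R) : borel cantor_space :=
  fun i => `[< exists k, half_open i.+1 k.*2.+1 x >].

Lemma binary_digits_half_open L (u : cantor_space) :
  exists k, [set x | half_open 0 0 x /\ agree L (binary_digits x) u] `<=` half_open L k.
Proof.
have succE n : n.+1%:R = n%:R + 1 :> R by rewrite -natr1.
have doubleE n : n.*2%:R = 2 * n%:R :> R by rewrite -mul2n natrM.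
elim: L => [|L [k IH]]; first by exists 0%N => x [].
exists (k.*2 + u L)%N => x [x01 xu].
have := IH x (conj x01 (agree_le (leqnSn _) xu)).
rewrite !in_half_open exprS mulrCA => /andP[kx xk].
have := xu L (leqnn _); rewrite /binary_digits.
case: (u L) => /=.
  move=> /asboolP[j]; rewrite in_half_open exprS mulrCA => /andP[jx xj].
  have -> : k = j.
    move: xj jx kx xk; rewrite (succE j.*2.+1) (succE j.*2) (succE k) doubleE => xj jx kx xk.
    apply/eqP; rewrite eqn_leq -(ltnS k) -(ltnS j); apply/andP.
    by split; rewrite -(ltr_nat R) succE; lra.
  by rewrite addn1 jx xj.
move=> /asboolPn hx; rewrite addn0.
have lo : k.*2%:R <= 2 * (x * 2 ^+ L) by rewrite doubleE ler_pM2l.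
rewrite lo ltNge; apply/negP => hi; apply: hx; exists k.
rewrite in_half_open exprS mulrCA hi /=.
by move: xk; rewrite (succE k) (succE k.*2.+1) (succE k.*2) doubleE; lra.
Qed.

Definition cylinder (s : seq bool) : set cantor_space :=
  [set y | agree (size s) y (nth false s)].

Lemma cylinder_take n (x y : cantor_space) : cylinder (mkseq x n) y <-> agree n y x.
Proof.
rewrite /cylinder /= size_mkseq; split=> h i ni; first by rewrite h// nth_mkseq.
by rewrite nth_mkseq ?h.
Qed.

Lemma open_bigcup_cylinder (U : set cantor_space) : open U ->
  U = \bigcup_s (if `[< cylinder s `<=` U >] then cylinder s else set0).
Proof.
move=> oU; apply/seteqP; split => x.
  move=> Ux; have /nbhs_agree[n nU] : nbhs x U by exact: open_nbhs_nbhs.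
  exists (mkseq x n) => //; case: asboolP => [_|[]]; first exact/cylinder_take.
  by move=> y /cylinder_take h; apply: nU => /=; exact: agree_sym.
by move=> [s _]; case: asboolP => // h; exact: h.
Qed.

Lemma measurable_binary_digits : measurable_fun [set: measurableTypeR R] binary_digits.
Proof.
apply: (@measurability _ _ _ (borel cantor_space) _ _ (@open cantor_space) erefl).
move=> _ [U oU <-]; rewrite setTI (open_bigcup_cylinder oU) preimage_bigcup.
apply: countable_bigcupT_measurable; first exact: countableP.
move=> s; case: ifP => _; last by rewrite preimage_set0.
rewrite (_ : _ @^-1` _ = \bigcap_(i in `I_(size s)) [set x | binary_digits x i = nth false s i]) //.
have mt i : measurable [set x : measurableTypeR R | binary_digits x i = true].
  rewrite (_ : [set x | _] = \bigcup_k half_open i.+1 k.*2.+1).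
    by apply: bigcupT_measurable => k; exact: measurable_itv.
  apply/seteqP; split => x; first by move=> /asboolP[k xk]; exists k.
  by move=> [k _ xk]; apply/asboolP; exists k.
apply: bigcap_measurableType => i _; case: (nth _ _ _) => //.
rewrite (_ : [set x | _] = ~` [set x | binary_digits x i = true]).
  exact: measurableC.
by apply/seteqP; split => x /=; case: (binary_digits x i).
Qed.

(** The coins are the binary digits of a uniform point of the unit interval. *)
Lemma coin_measure_exists : exists coin : probability (borel cantor_space) R,
  forall L u, (coin [set c | agree L c u] <= ((2 ^+ L)^-1)%:E)%E.
Proof.
have mI : measurable (half_open 0 0 : set (measurableTypeR R)) by exact: measurable_itv.
pose P0 : probability (measurableTypeR R) R :=
  mnormalize (mrestr (@lebesgue_measure R) mI) (\d_(0 : measurableTypeR R)).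
have P0E A : P0 A = lebesgue_measure (A `&` half_open 0 0).
  apply: (etrans (mnormalizeE _ A ltr01 _)); last by rewrite invr1 mule1.
  rewrite /= /mrestr setTI /half_open lebesgue_measure_itv /= lte_fin.
  by rewrite expr0 invr1 !mulr1 ltr01 -EFinB subr0.
have [coin coinE] := image_prob P0 measurable_binary_digits.
exists coin => L u; rewrite coinE P0E.
have [k hk] := binary_digits_half_open L u.
apply: (@le_trans _ _ (lebesgue_measure (half_open L k))).
  apply: le_measure; rewrite ?inE//; last by move=> x [xu x01]; exact: hk.
  apply: measurableI => //; rewrite -[X in measurable X]setTI.
  apply: measurable_binary_digits => //; apply: sub_sigma_algebra.
  rewrite (_ : [set c | _] = [set c | agree L u c]); first exact: open_agree.
  by apply/seteqP; split => c /=; exact: agree_sym.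
  exact: measurable_itv.
rewrite /half_open lebesgue_measure_itv /= lte_fin ltr_pM2r ?invr_gt0 ?exprn_gt0//.
rewrite ltr_nat ltnSn -EFinB -mulrBl -natr1 lee_fin.
by rewrite addrAC subrr add0r mul1r.
Qed.

(** Overwriting the coins in [J] arbitrarily is injective on the pairs of an
    outcome in [A] and a filling, as the other coins determine the outcome. *)
Lemma coin_isolated (coin : probability (borel cantor_space) R)
  (A : set cantor_space) L (J : seq nat) :
  (forall L u, (coin [set c | agree L c u] <= ((2 ^+ L)^-1)%:E)%E) ->
  (forall c c', agree L c c' -> A c -> A c') ->
  uniq J -> (forall i, i \in J -> (i < L)%N) ->
  (forall c c', A c -> A c' -> (forall i, i \notin J -> c i = c' i) ->
    forall i, i \in J -> c i = c' i) ->
  (coin A <= ((2 ^+ size J)^-1)%:E)%E.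
Proof.
move=> hcoin lA uJ JL isoA.
pose dec (t : L.-tuple bool) : cantor_space := nth false t.
have decE c : agree L c (dec (word L c)).
  by move=> i iL; rewrite /dec (nth_mktuple _ _ (Ordinal iL)).
pose X := [set t : L.-tuple bool | `[< A (dec t) >]]%SET.
have XJ : (#|X| * 2 ^ size J <= 2 ^ L)%N.
  pose g (q : L.-tuple bool * (size J).-tuple bool) : L.-tuple bool :=
    [tuple if val i \in J then nth false q.2 (index (val i) J) else tnth q.1 i | i < L].
  have gE q i (iL : (i < L)%N) : nth false (g q) i =
      if i \in J then nth false q.2 (index i J) else nth false q.1 i.
    rewrite (nth_mktuple _ _ (Ordinal iL)) /=; case: ifP => // _.
    by rewrite (tnth_nth false).
  have ginj : {in finset.setX X finset.setT &, injective g}.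
    move=> [t s] [t' s'] /finset.setXP[/= + _] /finset.setXP[/= + _].
    rewrite !inE => /asboolP/asboolP At /asboolP/asboolP At' e.
    have es : s = s'.
      apply: eq_from_tnth => j; rewrite !(tnth_nth false).
      have jJ : nth 0%N J j \in J by rewrite mem_nth.
      have := gE (t, s) _ (JL _ jJ).
      by rewrite e (gE _ _ (JL _ jJ)) jJ /= index_uniq.
    have off i : i \notin J -> dec t i = dec t' i.
      move=> iJ; have [iL|Li] := ltnP i L; last by rewrite /dec !nth_default// size_tuple.
      by have := gE (t, s) _ iL; rewrite e (gE _ _ iL) (negPf iJ) /=.
    have on := isoA _ _ At At' off.
    rewrite es; congr (_, _); apply: eq_from_tnth => j; rewrite !(tnth_nth false).
    by have [/on|/off] := boolP (val j \in J).
  have := subset_leq_card (finset.subsetT (g @: finset.setX X finset.setT)).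
  by rewrite card_in_imset// cardsX !finset.cardsT !card_tuple card_bool.
have AX : A = \big[setU/set0]_(t <- enum X) [set c | agree L c (dec t)].
  rewrite -bigcup_seq; apply/seteqP; split => c.
    move=> Ac; exists (word L c); last exact: decE.
    by rewrite /= mem_enum inE; apply/asboolP; exact: (lA _ _ (decE c) Ac).
  move=> [t /=]; rewrite mem_enum inE => /asboolP At ct.
  exact: (lA _ _ (agree_sym ct) At).
rewrite AX; apply: (@le_trans _ _ ((size (enum X))%:R * (2 ^+ L)^-1)%:E).
  apply: (@prob_bigU_le _ _ _ coin) => t; last exact: hcoin.
  apply: sub_sigma_algebra.
  rewrite (_ : [set c | _] = [set c | agree L (dec t) c]); first exact: open_agree.
  by apply/seteqP; split => c /=; exact: agree_sym.
rewrite lee_fin -cardE ler_pdivrMr ?exprn_gt0// mulrC ler_pdivlMr ?exprn_gt0//.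
by rewrite -!natrX -natrM ler_nat.
Qed.

End CoinMeasure.

(** * The random function *)

Section GeometricSeries.
Context {R : realType} (rho : R).
Hypotheses (rho0 : 0 <= rho) (rho1 : rho < 1).

Let rho1' : 0 < 1 - rho. Proof. by rewrite subr_gt0. Qed.

Lemma geometric_tail_le N M : \sum_(N <= l < M) rho ^+ l <= rho ^+ N / (1 - rho).
Proof.
have [NM|MN] := leqP N M; last first.
  by rewrite big_geq 1?ltnW// divr_ge0 ?exprn_ge0// ltW.
rewrite ler_pdivlMr// -(subnKC NM); elim: (M - N)%N => [|k IH].
  by rewrite addn0 big_geq// mul0r exprn_ge0.
suff -> : (\sum_(N <= l < N + k.+1) rho ^+ l) * (1 - rho) = rho ^+ N - rho ^+ (N + k.+1).
  by rewrite gerBl exprn_ge0.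
elim: k {IH} => [|k IH]; first by rewrite addn1 big_nat1 exprSr; lra.
by rewrite addnS big_nat_recr ?leq_addr//= mulrDl IH exprSr; lra.
Qed.

Lemma geometric_series_tail (V : completeNormedModType R) (u : V^nat) A :
  (forall n, `|u n| <= A * rho ^+ n) ->
  cvgn (series u) /\ forall N, `|limn (series u) - series u N| <= A * rho ^+ N / (1 - rho).
Proof.
move=> uA; have A0 : 0 <= A by have := uA 0%N; rewrite expr0 mulr1; exact: le_trans.
have cu : cvgn (series u).
  apply: normed_cvg; apply: (@series_le_cvg _ _ (geometric A rho)).
  - by move=> n; exact: normr_ge0.
  - by move=> n; rewrite mulr_ge0// exprn_ge0.
  - exact: uA.
  - by apply: is_cvg_geometric_series; rewrite ger0_norm.
split=> // N.
have : (fun M => `|series u M - series u N|) @ \oo --> `|limn (series u) - series u N|.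
  by apply: cvg_norm; apply: cvgB => //; exact: cvg_cst.
move/cvgr_to_le; apply; exists N => // M /= NM.
rewrite (sub_series_geq _ NM); apply: le_trans (ler_norm_sum _ _ _) _.
apply: (@le_trans _ _ (\sum_(N <= l < M) A * rho ^+ l)).
  by apply: ler_sum => i _; exact: uA.
by rewrite -mulr_sumr -mulrA ler_wpM2l// geometric_tail_le.
Qed.

End GeometricSeries.

(** The word [s] owns the coins numbered [pickle (s, j)], so that the values of
    distinct words are independent. *)
Definition coin_value k (s : seq bool) (c : cantor_space) : nat :=
  \sum_(j < k) c (pickle (s, val j)) * 2 ^ j.

Lemma coin_value_lt k s c : (coin_value k s c < 2 ^ k)%N.
Proof.
rewrite /coin_value; elim: k => [|k IH]; first by rewrite big_ord0.
rewrite big_ord_recr/= expnS mul2n -addnn.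
by case: (c _); rewrite ?mul1n ?mul0n ?addn0 ?ltn_add2r// (leq_trans IH)// leq_addl.
Qed.

Lemma coin_value_inj k s c c' : coin_value k s c = coin_value k s c' ->
  forall j, (j < k)%N -> c (pickle (s, j)) = c' (pickle (s, j)).
Proof.
have lt c0 l := coin_value_lt l s c0.
elim: k => // k IH; rewrite {1 2}/coin_value !big_ord_recr /=.
rewrite -!/(coin_value k s _) => e.
have ek : c (pickle (s, k)) = c' (pickle (s, k)).
  move: (lt c k) (lt c' k) e.
  by case: (c _); case: (c' _) => //; rewrite ?mul1n ?mul0n; lia.
move: e; rewrite ek => /addIn/IH h j; rewrite ltnS leq_eqVlt => /predU1P[->//|].
exact: h.
Qed.

Section Noise.
Context {R : realType} (a : decr_seq R).
Local Notation d := (dist_seq a).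
Implicit Types (c : cantor_space).

(** Such a function does not vary at all at distances below [a n]. *)
Lemma local_little_lip n (f : cantor_space -> R) B : local_fun n f ->
  (forall x y, `|f x - f y| <= B) -> f \in little_lip_pred a.
Proof.
move=> lf fB; have B0 : 0 <= B by exact: le_trans (fB point point).
apply/little_lip_predP/is_little_lipE; split.
  exists (B / a n) => x y; have [xy|xy] := pselect (agree n x y).
    by rewrite (lf _ _ xy) subrr normr0 mulr_ge0 ?dist_seq_ge0// divr_ge0// ltW ?decr_seq_gt0.
  apply: le_trans (fB x y) _; rewrite -mulrA ler_peMr// mulrC ler_pdivlMr ?decr_seq_gt0//.
  by rewrite mul1r; exact: (dist_nagree a xy).
move=> e e0; exists (a n); first exact: decr_seq_gt0.
move=> x y dxy; have [xy|xy] := pselect (agree n x y).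
  by rewrite (lf _ _ xy) subrr normr0 mulr_ge0 ?dist_seq_ge0// ltW.
by have := dist_nagree a xy; rewrite leNgt dxy.
Qed.

Lemma local_lip_const n (f : little_lip a) B : local_fun n f ->
  (forall x y, `|f x - f y| <= B) -> lip_const a f <= B / a n.
Proof.
move=> lf fB; have B0 : 0 <= B by exact: le_trans (fB point point).
apply: lip_const_le => x y; have [xy|xy] := pselect (agree n x y).
  by rewrite (lf _ _ xy) subrr normr0 mulr_ge0 ?dist_seq_ge0// divr_ge0// ltW ?decr_seq_gt0.
apply: le_trans (fB x y) _; rewrite -mulrA ler_peMr// mulrC ler_pdivlMr ?decr_seq_gt0//.
by rewrite mul1r; exact: (dist_nagree a xy).
Qed.

Variables (rho : R) (bits : nat -> nat).
Hypotheses (rho0 : 0 < rho) (rho1 : rho < 1).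

(** A function of [n] coordinates with oscillation [b] has Lipschitz constant at
    most [b / a n]; the factor [a n] turns this into the summable [rho ^+ n]. *)
Definition noise_size n : R := rho ^+ n * a n.

Definition noise_level n c (x : cantor_space) : R :=
  noise_size n / 2 ^+ bits n * (coin_value (bits n) (word n x) c)%:R.

Lemma noise_size_gt0 n : 0 < noise_size n.
Proof. by rewrite mulr_gt0 ?exprn_gt0// decr_seq_gt0. Qed.

Lemma noise_level_local n c : local_fun n (noise_level n c).
Proof. by move=> x y /wordP; rewrite /noise_level => ->. Qed.

Lemma noise_level_ge0 n c x : 0 <= noise_level n c x.
Proof. by rewrite !mulr_ge0 ?invr_ge0 ?exprn_ge0// ltW ?decr_seq_gt0. Qed.

Lemma noise_level_le n c x : noise_level n c x <= noise_size n.
Proof.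
rewrite /noise_level -mulrA ler_piMr//; first exact/ltW/noise_size_gt0.
rewrite mulrC ler_pdivrMr ?exprn_gt0// mul1r -natrX ler_nat ltnW//.
exact: coin_value_lt.
Qed.

Lemma noise_level_osc n c x y : `|noise_level n c x - noise_level n c y| <= noise_size n.
Proof.
have := noise_level_ge0 n c x; have := noise_level_ge0 n c y.
have := noise_level_le n c x; have := noise_level_le n c y.
by move=> *; apply/ler_normlP; split; lra.
Qed.

Definition noise_term n c : little_lip a :=
  LittleLip (local_little_lip (@noise_level_local n c) (noise_level_osc n c)).

Lemma noise_term_norm n c : `|noise_term n c| <= (a 0%N + 1) * rho ^+ n.
Proof.
rewrite little_lip_normE mulrDl mul1r lerD//.
  apply: sup_norm_le => x; rewrite ger0_norm ?noise_level_ge0//.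
  apply: le_trans (noise_level_le n c x) _.
  rewrite /noise_size mulrC ler_wpM2r//; last exact: decr_seq_le.
  by rewrite exprn_ge0// ltW.
apply: le_trans (@local_lip_const n (noise_term n c) _ (@noise_level_local n c) (noise_level_osc n c)) _.
by rewrite mulfK// gt_eqF// decr_seq_gt0.
Qed.

Definition noise c : little_lip a := limn (series (noise_term ^~ c)).

Let noise_tail c := geometric_series_tail (ltW rho0) rho1 (noise_term_norm ^~ c).

Lemma noise_norm_tail c N :
  `|noise c - series (noise_term ^~ c) N| <= (a 0%N + 1) * rho ^+ N / (1 - rho).
Proof. exact: (noise_tail c).2. Qed.

Lemma noise_norm c : `|noise c| <= (a 0%N + 1) / (1 - rho).
Proof.
have := noise_norm_tail c 0.
by rewrite /series/= big_geq// subr0 expr0 mulr1.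
Qed.

Lemma series_noiseE c N x :
  (series (noise_term ^~ c) N : little_lip a) x = \sum_(0 <= l < N) noise_level l c x.
Proof.
rewrite /series /=; elim: N => [|N IH]; first by rewrite !big_geq.
by rewrite !big_nat_recr//= -IH.
Qed.

Lemma little_lip_norm_ge (F : little_lip a) x : `|F x| <= `|F|.
Proof. by apply: le_trans (sup_norm_ge F x) _; rewrite lerDl lip_const_ge0. Qed.

Let expr_small A (e : R) : 0 < e -> exists N, A * rho ^+ N < e.
Proof.
move=> e0; have : (fun N => A * rho ^+ N) @ \oo --> (0 : R).
  by apply: cvg_geometric; rewrite ger0_norm// ltW.
move/cvgr_lt => /(_ _ e0)[N _ /(_ N (leqnn N))]; by exists N.
Qed.

(** Pointwise the tail is much smaller than in norm: the sizes
    [rho ^+ l * a l] for [l >= N] are at most [rho ^+ l * a N]. *)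
Lemma noise_tail_le c N x :
  `|noise c x - \sum_(0 <= l < N) noise_level l c x| <= a N / (1 - rho).
Proof.
apply/ler_addgt0Pr => e e0.
have [M hM] := expr_small ((a 0%N + 1) / (1 - rho)) e0.
set K := maxn M N.
have h1 : `|noise c x - \sum_(0 <= l < K) noise_level l c x| <= e.
  rewrite -series_noiseE -little_lip_subE; apply: le_trans (little_lip_norm_ge _ _) _.
  apply: le_trans (noise_norm_tail c K) _; apply: le_trans (ltW hM).
  rewrite mulrAC ler_wpM2l//; last first.
    by apply: ler_wiXn2l; [exact: ltW | exact: ltW | exact: leq_maxl].
  apply: divr_ge0; last by rewrite subr_ge0 ltW.
  by rewrite addr_ge0// ltW// decr_seq_gt0.
have h2 : `|\sum_(0 <= l < K) noise_level l c x - \sum_(0 <= l < N) noise_level l c x|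
    <= a N / (1 - rho).
  rewrite (@big_cat_nat _ _ _ N 0 K)//=; last exact: leq_maxr.
  rewrite addrAC subrr add0r ger0_norm; last by apply: sumr_ge0 => l _; exact: noise_level_ge0.
  apply: (@le_trans _ _ (\sum_(N <= l < K) a N * rho ^+ l)).
    rewrite big_nat [leRHS]big_nat; apply: ler_sum => l /andP[Nl _].
    apply: le_trans (noise_level_le _ _ _) _.
    rewrite /noise_size mulrC ler_wpM2r//; last exact: decr_seq_le.
    by rewrite exprn_ge0// ltW.
  rewrite -mulr_sumr ler_wpM2l//; first exact/ltW/decr_seq_gt0.
  apply: le_trans (geometric_tail_le (ltW rho0) rho1 _ _) _.
  by rewrite ler_pdivrMr ?subr_gt0// mulVf ?gt_eqF ?subr_gt0// exprn_ile1 ?ltW.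
rewrite -(subrKA (\sum_(0 <= l < K) noise_level l c x)).
by apply: le_trans (ler_normD _ _) _; rewrite [leRHS]addrC lerD.
Qed.

(** Partial sums of the noise, and the ties that they create, are thus decided
    by finitely many coins. *)
Lemma coins_bounded N : exists L, forall l, (l < N)%N -> forall (e : l.-tuple bool) j,
  (j < bits l)%N -> (pickle (tval e, j) < L)%N.
Proof.
exists (\max_(l < N) \max_(e : l.-tuple bool) \max_(j < bits l) (pickle (tval e, val j)).+1).
move=> l lN e j jl.
apply: (@leq_trans (\max_(e : l.-tuple bool) \max_(j < bits l) (pickle (tval e, val j)).+1)); last first.
  exact: (@leq_bigmax _ (fun l : 'I_N => \max_(e : l.-tuple bool) \max_(j < bits l) (pickle (tval e, val j)).+1) (Ordinal lN)).
apply: leq_trans (leq_bigmax e).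
exact: (@leq_bigmax _ (fun j : 'I_(bits l) => (pickle (tval e, val j)).+1) (Ordinal jl)).
Qed.

Lemma noise_level_coins N L l c c' :
  (forall l, (l < N)%N -> forall (e : l.-tuple bool) j,
  (j < bits l)%N -> (pickle (tval e, j) < L)%N) ->
  (l < N)%N -> agree L c c' -> noise_level l c = noise_level l c'.
Proof.
move=> hL lN cc; apply/funext => x; rewrite /noise_level; congr (_ * _%:R).
by apply: eq_bigr => j _; rewrite (cc _ (hL _ lN _ _ (ltn_ord j))).
Qed.

Lemma noise_continuous : continuous (noise : cantor_space -> little_lip a).
Proof.
move=> c; apply/cvgrPdist_lt => e e0.
have [N hN] := expr_small ((a 0%N + 1) / (1 - rho)) (divr_gt0 e0 (ltr0Sn _ 1)).
have [L hL] := coins_bounded N.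
suff : nbhs c [set c' | `|noise c - noise c'| < e] by [].
apply: (@filterS _ _ _ [set c' | agree L c c']); last first.
  exact: agree_nbhs.
move=> c' /= cc.
have same : series (noise_term ^~ c) N = series (noise_term ^~ c') N :> little_lip a.
  apply/val_inj/funext => x /=; rewrite !series_noiseE big_nat [RHS]big_nat.
  by apply: eq_bigr => l lN; rewrite (noise_level_coins hL _ cc).
rewrite -(subrKA (series (noise_term ^~ c) N)) {2}same.
apply: le_lt_trans (ler_normD _ _) _; rewrite (distrC _ (noise c')).
have := noise_norm_tail c N; have := noise_norm_tail c' N.
move: hN; rewrite mulrAC; lra.
Qed.

End Noise.

(** * From isolated cycles to locking *)

Section Lock.
Context {R : realType} (a : decr_seq R).
Local Notation d := (dist_seq a).

Lemma halving_small n : (forall k, (n <= k)%N -> 2 * a k.+1 <= a k) ->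
  forall e, 0 < e -> exists k, a k < e.
Proof.
move=> ha e e0.
have geo j : a (n + j)%N <= a n * 2^-1 ^+ j.
  elim: j => [|j IH]; first by rewrite addn0 expr0 mulr1.
  rewrite addnS exprS mulrCA -ler_pdivrMl ?invr_gt0// invrK.
  by apply: le_trans IH; apply: ha; exact: leq_addr.
have : (fun j => a n * 2^-1 ^+ j) @ \oo --> (0 : R).
  by apply: cvg_geometric; rewrite ger0_norm ?invr_ge0// invf_lt1// ltr1n.
move/cvgr_lt => /(_ _ e0)[j _ /(_ j (leqnn j)) h].
by exists (n + j)%N; exact: le_lt_trans (geo j) h.
Qed.

Lemma little_lip_continuous (F : little_lip a) :
  (forall e, 0 < e -> exists k, a k < e) -> continuous F.
Proof.
move=> a_small x; apply/cvgrPdist_lt => e e0.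
have L0 : 0 < lip_const a F + 1 by rewrite ltr_wpDl// lip_const_ge0.
have [n an] := a_small _ (divr_gt0 e0 L0).
suff : nbhs x [set y | `|F x - F y| < e] by [].
apply: (@filterS _ _ _ [set y | agree n x y]); last first.
  exact: agree_nbhs.
move=> y /= xy; apply: le_lt_trans (lip_const_ge F x y) _.
apply: (@le_lt_trans _ _ ((lip_const a F + 1) * d x y)).
  by rewrite ler_wpM2r ?dist_seq_ge0// lerDl.
rewrite mulrC -ltr_pdivlMr//; apply: le_lt_trans (dist_agree a xy) _.
by apply: le_lt_trans an; exact: decr_seq_le.
Qed.

(** Functions in a ball of radius at most [a m.+2] and at most 1 about [F] still
    satisfy the hypotheses of the locking estimate, with the same cycle. *)
Lemma lock_of_untied m (F : little_lip a) (phi : cantor_space -> R) (K delta : R) :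
  local_fun m.+1 phi -> 0 <= K ->
  (forall x, `|F x - phi x| <= K * a m.+2) ->
  (forall k, (m.+1 <= k)%N -> 2 * a k.+1 <= a k) ->
  5 * ((K + lip_const a F + 1) * a m.+2) < delta ->
  (forall e : m.+1.-tuple bool, ~ tied_at phi delta e) -> lock_shift a F.
Proof.
move=> lphi K0 Fphi ha dlt unt.
have [w [p opt]] := optimal_cycle_exists m phi; have [sw _] := opt.
have an0 : 0 < a m.+2 by exact: decr_seq_gt0.
set A := lip_const a F + 1; set kappa := (K + lip_const a F + 1) * a m.+2.
have near_max : \forall G \near F, unique_maximizing (G : little_lip a) (orbit_prob w p).
  apply/nbhs_ballP; exists (Num.min 1 (a m.+2)); first by rewrite /= lt_min ltr01.
  move=> G; rewrite -ball_normE /= lt_min => /andP[FG1 FGa].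
  have Gphi x : `|G x - phi x| <= kappa.
    rewrite -(subrKA (F x)); apply: le_trans (ler_normD _ _) _.
    have : `|G x - F x| <= a m.+2.
      by rewrite distrC; exact: le_trans (little_lip_norm_ge (F - G) x) (ltW FGa).
    have : 0 <= lip_const a F * a m.+2 by rewrite mulr_ge0 ?lip_const_ge0// ltW.
    have := Fphi x; rewrite /kappa; lra.
  have GA x y : `|G x - G y| <= A * d x y.
    have -> : G x - G y = (F x - F y) - ((F - G) x - (F - G) y).
      by rewrite !little_lip_subE; lra.
    apply: le_trans (ler_normB _ _) _; rewrite /A mulrDl mul1r lerD ?lip_const_ge//.
    apply: le_trans (lip_const_ge _ _ _) _; rewrite ler_piMl ?dist_seq_ge0//.
    apply: le_trans (ltW FG1); rewrite little_lip_normE lerDr.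
    exact: sup_norm_ge0.
  have A0 : 0 <= A by rewrite addr_ge0// lip_const_ge0.
  have Ak : A * a m.+2 <= kappa.
    by rewrite ler_wpM2r ?(ltW an0)// -addrA lerDr.
  have [C _ hC] := locking lphi sw (untied_gap opt unt) Gphi A0 GA Ak ha (ltW dlt).
  apply: (orbit_prob_unique sw (s := delta - 5 * kappa)) hC.
    split; last by exists `|G| => x; exact: little_lip_norm_ge.
    by apply: borel_continuous; exact: little_lip_continuous (halving_small ha).
  by rewrite subr_gt0.
exists (orbit_prob w p); split => //; first exact: nbhs_singleton near_max.
exact: orbit_prob_periodic sw.
Qed.

End Lock.

(** * The probability of a tie *)

Section NoiseIsGeneric.
Context {R : realType} (a : decr_seq R) (rho : R) (bits : nat -> nat).
Hypotheses (rho0 : 0 < rho) (rho1 : rho < 1).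
Variable coin : probability (borel cantor_space) R.
Hypothesis coin_cylinder : forall L u,
  (coin [set c | agree L c u] <= ((2 ^+ L)^-1)%:E)%E.
Variable f : little_lip a.

Definition pad n (x : cantor_space) : cantor_space :=
  fun i => if (i < n)%N then x i else false.

Lemma pad_local n x y : agree n x y -> pad n x = pad n y.
Proof. by move=> xy; apply/funext => i; rewrite /pad; case: ltnP => // /xy. Qed.

Lemma pad_agree n x : agree n x (pad n x).
Proof. by move=> i; rewrite /pad => ->. Qed.

Definition truncated_potential n c x : R :=
  f (pad n x) + \sum_(0 <= l < n.+1) noise_level a rho bits l c x.

Lemma truncated_potential_local n c : local_fun n (truncated_potential n c).
Proof.
move=> x y xy; rewrite /truncated_potential (pad_local xy); congr (_ + _).
rewrite big_nat [RHS]big_nat; apply: eq_bigr => l; rewrite ltnS => ln.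
by apply: noise_level_local; exact: agree_le xy.
Qed.

Lemma truncated_potential_error n c x :
  `|f x + noise a bits rho0 c x - truncated_potential n c x| <=
    (lip_const a f + (1 - rho)^-1) * a n.+1.
Proof.
rewrite /truncated_potential opprD addrACA; apply: le_trans (ler_normD _ _) _.
rewrite mulrDl lerD//; last by rewrite mulrC; exact: noise_tail_le.
apply: le_trans (lip_const_ge f _ _) _; rewrite ler_wpM2l ?lip_const_ge0//.
by apply: dist_agree; exact: pad_agree.
Qed.

Lemma lip_const_noise c :
  lip_const a (f + noise a bits rho0 c : little_lip a) <= lip_const a f + (a 0%N + 1) / (1 - rho).
Proof.
apply: lip_const_le => x y; rewrite !little_lip_addE opprD addrACA mulrDl.
apply: le_trans (ler_normD _ _) _; rewrite lerD ?lip_const_ge//.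
apply: le_trans (lip_const_ge _ _ _) _; rewrite ler_wpM2r ?dist_seq_ge0//.
apply: le_trans (noise_norm a bits rho0 rho1 c).
by rewrite little_lip_normE lerDr sup_norm_ge0.
Qed.

Definition coins_of k (s : seq bool) : seq nat := [seq pickle (s, j) | j <- iota 0 k].

Let pickle_word n (e : n.-tuple bool) (s : seq bool) (i : nat) :
  pickle (s, i) \in coins_of (bits n) e ->
  s = e /\ (i < bits n)%N.
Proof.
move=> /mapP[k]; rewrite mem_iota add0n /= => kn.
by move=> /(pcan_inj pickleK)[-> ->].
Qed.

Let truncated_potential_shift n c c' (e : n.-tuple bool) :
  (forall i, i \notin coins_of (bits n) e -> c i = c' i) ->
  forall x, truncated_potential n c' x = truncated_potential n c x +
    noise_size a rho n / 2 ^+ bits n *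
      ((coin_value (bits n) e c')%:R - (coin_value (bits n) e c)%:R) *
      (word n x == e)%:R.
Proof.
move=> cc x.
have other k (s : seq bool) : s <> e -> coin_value k s c = coin_value k s c'.
  move=> se; apply: eq_bigr => j _; rewrite cc//; apply/negP.
  by move=> /pickle_word[/se].
rewrite /truncated_potential !big_nat_recr//=.
rewrite (_ : \sum_(0 <= l < n) noise_level a rho bits l c' x =
  \sum_(0 <= l < n) noise_level a rho bits l c x); last first.
  rewrite big_nat [RHS]big_nat; apply: eq_bigr => l /andP[_ ln].
  rewrite /noise_level other// => /(congr1 size); rewrite !size_tuple => e'.
  by rewrite e' ltnn in ln.
rewrite -!addrA; do 2! congr (_ + _); rewrite /noise_level.
have [->|h] := eqVneq (word n x) e; first by rewrite mulr1; lra.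
by rewrite mulr0 addr0 other// => /val_inj/eqP; exact/negP.
Qed.

Lemma tied_local m (delta : R) (e : m.+1.-tuple bool) : exists2 L,
  (forall c c', agree L c c' ->
    tied_at (truncated_potential m.+1 c) delta e ->
    tied_at (truncated_potential m.+1 c') delta e) &
  forall i, i \in coins_of (bits m.+1) e -> (i < L)%N.
Proof.
have [L hL] := coins_bounded bits m.+2; exists L.
  move=> c c' cc; rewrite (_ : truncated_potential m.+1 c = truncated_potential m.+1 c')//.
  apply/funext => x; congr (_ + _); rewrite big_nat [RHS]big_nat.
  by apply: eq_bigr => l lm; rewrite (noise_level_coins _ _ hL _ cc).
move=> i /mapP[j]; rewrite mem_iota add0n /= => jm ->.
exact: hL.
Qed.

Lemma open_some_tied m (delta : R) :
  open [set c | exists e : m.+1.-tuple bool, tied_at (truncated_potential m.+1 c) delta e].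
Proof.
rewrite (_ : [set c | _] = \bigcup_(e : m.+1.-tuple bool)
    [set c | tied_at (truncated_potential m.+1 c) delta e]).
  by apply: bigcup_open => e _; have [L lL _] := tied_local delta e; exact: open_local lL.
by apply/seteqP; split => c [e]; exists e.
Qed.

(** By isolation two outcomes that tie at [e] and differ only in the coins of [e]
    give this word the same value, hence are equal. *)
Lemma coin_tied_le m (delta : R) (e : m.+1.-tuple bool) : 0 <= delta ->
  delta * (2 ^ m)%:R <= noise_size a rho m.+1 / 2 ^+ bits m.+1 ->
  (coin [set c | tied_at (truncated_potential m.+1 c) delta e]
     <= ((2 ^+ bits m.+1)^-1)%:E)%E.
Proof.
move=> d0 dm; have [L lL JL] := tied_local delta e.
set J := coins_of _ _ in JL *.
have -> : bits m.+1 = size J by rewrite size_map size_iota.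
apply: (coin_isolated coin_cylinder lL) => //.
  rewrite map_inj_uniq ?iota_uniq//.
  by move=> j j' /(pcan_inj pickleK)[].
have isolated c c' : tied_at (truncated_potential m.+1 c) delta e ->
    tied_at (truncated_potential m.+1 c') delta e ->
    (forall i, i \notin J -> c i = c' i) ->
    (coin_value (bits m.+1) e c' <= coin_value (bits m.+1) e c)%N.
  move=> tc tc' cc; rewrite leqNgt; apply/negP => lt.
  apply: (tied_at_isolated (truncated_potential_shift cc) d0 _ tc tc').
  apply: le_trans dm _; rewrite ler_peMr//.
    by rewrite divr_ge0 ?exprn_ge0// ltW// noise_size_gt0.
  by rewrite -natrB ?(ltnW lt)// ler1n subn_gt0.
move=> c c' tc tc' cc i /mapP[j]; rewrite mem_iota add0n /= => jm ->.
have := isolated _ _ tc tc' cc; have := isolated _ _ tc' tc (fun i h => esym (cc i h)).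
move=> le1 le2.
have same : coin_value (bits m.+1) e c = coin_value (bits m.+1) e c'.
  by apply/eqP; rewrite eqn_leq le1 le2.
exact: (coin_value_inj same jm).
Qed.

Lemma coin_some_tied_le m (delta : R) : 0 <= delta ->
  delta * (2 ^ m)%:R <= noise_size a rho m.+1 / 2 ^+ bits m.+1 ->
  (coin [set c | exists e : m.+1.-tuple bool, tied_at (truncated_potential m.+1 c) delta e]
     <= ((2 ^ m.+1)%:R / 2 ^+ bits m.+1)%:E)%E.
Proof.
move=> d0 dm.
have -> : [set c | exists e : m.+1.-tuple bool, tied_at (truncated_potential m.+1 c) delta e] =
    \big[setU/set0]_(e <- enum {: m.+1.-tuple bool})
      [set c | tied_at (truncated_potential m.+1 c) delta e].
  rewrite -bigcup_seq; apply/seteqP; split => c.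
    by move=> [e he]; exists e => //=; rewrite mem_enum.
  by move=> [e _ he]; exists e.
have -> : (2 ^ m.+1)%N = size (enum {: m.+1.-tuple bool}).
  by rewrite -cardE card_tuple card_bool.
apply: (@prob_bigU_le _ _ _ coin) => e; last exact: coin_tied_le.
have [L lL _] := tied_local delta e.
by apply: sub_sigma_algebra; exact: open_local lL.
Qed.

Lemma lock_shift_open : open (lock_shift a).
Proof.
rewrite openE => F [mu [Fmax per /nbhs_interior nearF]].
apply: filterS nearF => G nearG; exists mu; split => //.
exact: nbhs_singleton nearG.
Qed.

End NoiseIsGeneric.

(** * Comparison of the noise with the metric *)

(** Any number strictly between [4 * theta] and 1 would do. *)
Definition noise_rate (R : realType) (theta : R) : R := (1 + 4 * theta) / 2.

Lemma noise_rate_gt0 (R : realType) (theta : R) : 0 < theta -> 0 < noise_rate theta.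
Proof. by rewrite /noise_rate; lra. Qed.

Lemma noise_rate_lt1 (R : realType) (theta : R) : theta < 1 / 4 -> noise_rate theta < 1.
Proof. by rewrite /noise_rate; lra. Qed.

Section Growth.
Context {R : realType}.

Lemma bernoulli_ineq (h : R) n : 0 <= h -> 1 + n%:R * h <= (1 + h) ^+ n.
Proof.
move=> h0; elim: n => [|n IH]; first by rewrite mul0r addr0 expr0.
have h1 : 0 <= 1 + h by rewrite addr_ge0.
rewrite exprS; apply: le_trans (ler_wpM2l h1 IH).
have : 0 <= h * (n%:R * h) by rewrite !mulr_ge0.
by rewrite -natr1; lra.
Qed.

Lemma linear_geometric_small (x K : R) : 0 < x -> x < 1 ->
  exists N, forall n, (N <= n)%N -> K * n.+1%:R * x ^+ n <= 1.
Proof.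
move=> x0 x1; pose y := (1 + x) / 2; pose h := y / x - 1.
have y0 : 0 < y by rewrite /y; lra.
have y1 : y < 1 by rewrite /y; lra.
have h0 : 0 < h by rewrite subr_gt0 ltr_pdivlMr// mul1r /y; lra.
(* [x / y = 1 / (1 + h)], whose powers beat [n.+1] by the Bernoulli inequality,
   while the powers of [y] still tend to 0. *)
pose c := 1 + h^-1.
have lin n : n.+1%:R * (x / y) ^+ n <= c.
  have -> : x / y = (1 + h)^-1.
    have -> : 1 + h = y / x by rewrite /h; lra.
    by rewrite [RHS]invf_div.
  rewrite exprVn ler_pdivrMr; last by rewrite exprn_gt0// addr_gt0.
  have c0 : 0 <= c by rewrite addr_ge0// invr_ge0 ltW.
  apply: le_trans (ler_wpM2l c0 (bernoulli_ineq n (ltW h0))).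
  have : 0 <= h^-1 by rewrite invr_ge0 ltW.
  have : 0 <= n%:R * h by rewrite mulr_ge0// ltW.
  have : h^-1 * (n%:R * h) = n%:R by rewrite mulrCA mulVf ?mulr1// gt_eqF.
  by rewrite /c -natr1; lra.
have : (fun n => (`|K| * c) * y ^+ n) @ \oo --> (0 : R).
  by apply: cvg_geometric; rewrite ger0_norm// ltW.
move/cvgr_lt => /(_ 1 ltr01)[N _ hN]; exists N => n /hN /= /ltW; apply: le_trans.
have -> : x ^+ n = (x / y) ^+ n * y ^+ n by rewrite -exprMn divfK// gt_eqF.
rewrite mulrA ler_wpM2r ?exprn_ge0 ?(ltW y0)// -mulrA.
apply: (@le_trans _ _ (`|K| * (n.+1%:R * (x / y) ^+ n))).
  rewrite ler_wpM2r ?ler_norm// mulr_ge0// exprn_ge0// divr_ge0//; exact: ltW.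
by rewrite ler_wpM2l.
Qed.

Variables (theta : R) (a : decr_seq R).
Hypotheses (theta_gt0 : 0 < theta) (theta_lt : theta < 1 / 4).
Hypothesis a_ratio : (fun n : nat => a n.+1 / a n) =O_ \oo (fun n : nat => theta ^+ n).

(** Each word of length [n] draws one of about [n * 2 ^ n] values, so that the
    union bound over the [2 ^ n] words still leaves a probability of order
    [1 / n]. *)
Definition coin_count n := (n + trunc_log 2 n.+1)%N.

Lemma coin_count_le n : (2 ^ coin_count n <= 2 ^ n * n.+1)%N.
Proof. by rewrite expnD leq_mul2l trunc_logP// orbT. Qed.

Lemma coin_count_gt n : (2 ^ n * n.+1 < 2 * 2 ^ coin_count n)%N.
Proof. by rewrite expnD mulnCA -expnS ltn_pmul2l ?expn_gt0// trunc_log_ltn. Qed.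

Let ratio_bound : exists2 C, 0 < C & exists N, forall n, (N <= n)%N ->
  a n.+1 <= C * theta ^+ n * a n.
Proof.
have /eqO_exP[C C0 [N _ hN]] := a_ratio; exists C => //; exists N => n Nn.
have an := decr_seq_gt0 a n; rewrite -ler_pdivrMr//; have := hN n Nn.
rewrite /= (ger0_norm (exprn_ge0 _ (ltW theta_gt0))).
by apply: le_trans; exact: ler_norm.
Qed.

(** The threshold 1/4 enters here: the right-hand side of the second inequality,
    the mesh of the noise at level [n], is [noise_rate theta ^+ n * a n] divided
    by about [n * 2 ^ n], while [a n.+1] is at most [theta ^+ n * a n] up to a
    constant, so the inequality amounts to the smallness of
    [n * (4 * theta / noise_rate theta) ^+ n]. *)
Lemma growth (M : R) : 0 <= M -> exists N, forall n, (N <= n)%N ->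
  2 * a n.+1 <= a n /\
  M * a n.+1 * (2 ^ n)%:R <= noise_size a (noise_rate theta) n / 2 ^+ coin_count n.
Proof.
move=> M0; have [C C0 [N1 hC]] := ratio_bound.
have theta1 : theta < 1 by move: theta_lt; lra.
have rho0 := noise_rate_gt0 theta_gt0.
pose x := 4 * theta / noise_rate theta.
have x0 : 0 < x by rewrite divr_gt0// mulr_gt0.
have x1 : x < 1 by rewrite ltr_pdivrMr// mul1r /noise_rate; move: theta_lt; lra.
have [N2 h2] := linear_geometric_small (2 * C) theta_gt0 theta1.
have [N3 h3] := linear_geometric_small (M * C) x0 x1.
exists (maxn N1 (maxn N2 N3)) => n; rewrite !geq_max => /and3P[/hC n1 /h2 n2 /h3 n3].
have an := decr_seq_gt0 a n; split.
  have Ct : 0 <= 2 * C * theta ^+ n by rewrite !mulr_ge0 ?exprn_ge0 ?(ltW C0) ?(ltW theta_gt0).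
  have le1 : 2 * C * theta ^+ n <= 1.
    apply: le_trans n2; rewrite [leRHS]mulrAC ler_peMr// ler1n//.
  have := ler_wpM2r (ltW an) le1; move: n1; lra.
rewrite ler_pdivlMr ?exprn_gt0//.
have step1 : M * a n.+1 * (2 ^ n)%:R <= M * (C * theta ^+ n * a n) * (2 ^ n)%:R.
  by rewrite ler_wpM2r// ler_wpM2l.
have step2 : 2 ^+ coin_count n <= (2 ^ n * n.+1)%:R :> R.
  by rewrite -natrX ler_nat coin_count_le.
have Mn : 0 <= M * a n.+1 * (2 ^ n)%:R by rewrite !mulr_ge0// ltW// decr_seq_gt0.
have two0 : 0 <= 2 ^+ coin_count n :> R by rewrite exprn_ge0.
apply: le_trans (ler_pM Mn two0 step1 step2) _.
have -> : M * (C * theta ^+ n * a n) * (2 ^ n)%:R * (2 ^ n * n.+1)%:R =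
    (M * C * n.+1%:R * x ^+ n) * noise_size a (noise_rate theta) n.
  rewrite /x expr_div_n exprMn /noise_size.
  have -> : 4 = 2 * 2 :> R by lra.
  rewrite exprMn natrM natrX; field.
  by rewrite expf_neq0// gt_eqF.
by rewrite ler_piMl// ltW// noise_size_gt0.
Qed.

End Growth.

(** * Prevalence *)

Section Prevalent.
Context {R : realType} (theta : R) (a : decr_seq R).
Hypotheses (theta_gt0 : 0 < theta) (theta_lt : theta < 1 / 4).
Hypothesis a_ratio : (fun n : nat => a n.+1 / a n) =O_ \oo (fun n : nat => theta ^+ n).
Let rho := noise_rate theta.
Let rho0 : 0 < rho := noise_rate_gt0 theta_gt0.
Let rho1 : rho < 1 := noise_rate_lt1 theta_lt.
Local Notation Noise := (noise a coin_count rho0).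

Lemma a_small e : 0 < e -> exists k, a k < e.
Proof.
have [N hN] := growth theta_gt0 theta_lt a_ratio (lexx 0).
by apply: (@halving_small _ _ N) => k /hN[].
Qed.

Lemma measurable_noise :
  measurable_fun [set: borel cantor_space] (Noise : borel cantor_space -> borel (little_lip a)).
Proof.
apply: (@measurability _ _ _ (borel (little_lip a)) _ _ (@open (little_lip a)) erefl).
move=> _ [U oU <-]; rewrite setTI; apply: sub_sigma_algebra.
by apply: open_comp => // c _; exact: noise_continuous.
Qed.

Lemma measurable_not_lock :
  measurable (~` lock_shift a : set (borel (little_lip a))).
Proof. by apply: measurableC; apply: sub_sigma_algebra; exact: lock_shift_open. Qed.

Variable coin : probability (borel cantor_space) R.
Hypothesis coin_cylinder : forall L u,
  (coin [set c | agree L c u] <= ((2 ^+ L)^-1)%:E)%E.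

(** Failing to lock forces a tie at every large level [n], an event of
    probability of order [1 / n]. *)
Lemma coin_not_lock (f : little_lip a) :
  coin [set c | ~ lock_shift a (f + Noise c)] = 0%E.
Proof.
set S := [set c | _].
have mS : measurable (S : set (borel cantor_space)).
  have -> : S = (fun c => f + Noise c) @^-1` (~` lock_shift a) by [].
  rewrite -[X in measurable X]setTI.
  apply: (@measurable_comp _ _ _ _ _ (borel (little_lip a)) setT
    (fun F : borel (little_lip a) => (f + F : little_lip a) : borel (little_lip a)) _
    (Noise : borel cantor_space -> borel (little_lip a))) => //; last 2 first.
  - exact: measurable_noise.
  - exact: measurable_not_lock.
  apply: (@measurability _ _ _ (borel (little_lip a)) _ _ (@open (little_lip a)) erefl).
  move=> _ [U oU <-]; rewrite setTI; apply: sub_sigma_algebra.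
  apply: open_comp => // F _; apply: continuousD; [exact: cst_continuous | by move=> ?].
pose K := lip_const a f + (1 - rho)^-1.
pose L := lip_const a f + (a 0%N + 1) / (1 - rho).
(* [K + L + 1] is what [lock_of_untied] asks for; one more makes it strict. *)
pose M := 5 * (K + L + 2).
have inv0 : 0 <= (1 - rho)^-1 by rewrite invr_ge0 subr_ge0 ltW.
have K0 : 0 <= K by rewrite addr_ge0// lip_const_ge0.
have L0 : 0 <= L.
  by rewrite addr_ge0 ?lip_const_ge0// mulr_ge0// addr_ge0// ltW// decr_seq_gt0.
have M0 : 0 <= M by rewrite /M; lra.
have [N hN] := growth theta_gt0 theta_lt a_ratio M0.
have S_le m : (N <= m)%N -> (coin S <= (2 / m.+2%:R)%:E)%E.
  move=> Nm; have an0 := decr_seq_gt0 a m.+2.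
  have [_ hn] := hN m.+1 (leqW Nm).
  pose delta := M * a m.+2.
  have d0 : 0 <= delta by rewrite mulr_ge0// ltW.
  have dm : delta * (2 ^ m)%:R <= noise_size a rho m.+1 / 2 ^+ coin_count m.+1.
    by apply: le_trans hn; rewrite ler_wpM2l// ler_nat leq_exp2l.
  pose T := [set c | exists e : m.+1.-tuple bool,
    tied_at (truncated_potential rho coin_count f m.+1 c) delta e].
  have ST : S `<=` T.
    move=> c; apply: contra_notP => /forallNP unt.
    apply: (lock_of_untied (truncated_potential_local rho coin_count f c) K0 _ _ _ unt).
    - by move=> x; exact: truncated_potential_error.
    - by move=> k mk; have [] := hN k (leq_trans (leqW Nm) mk).
    - have := lip_const_noise coin_count rho0 rho1 f c.
      rewrite -/L /delta mulrA => h; rewrite ltr_pM2r// /M; lra.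
  have mT : measurable (T : set (borel cantor_space)).
    by apply: sub_sigma_algebra; exact: open_some_tied.
  apply: (@le_trans _ _ (coin T)); first by apply: le_measure; rewrite ?inE.
  apply: le_trans (coin_some_tied_le rho0 coin_cylinder f d0 dm) _.
  rewrite lee_fin ler_pdivrMr ?exprn_gt0// mulrAC ler_pdivlMr// -natrX -!natrM ler_nat.
  exact: ltnW (coin_count_gt m.+1).
apply/eqP; rewrite eq_le measure_ge0 andbT; apply/lee_addgt0Pr => e e0.
rewrite add0e.
pose k := maxn N (Num.truncn (2 / e)).
apply: le_trans (S_le k (leq_maxl _ _)) _; rewrite lee_fin ler_pdivrMr//.
rewrite mulrC -ler_pdivrMr//; apply: ltW; apply: lt_le_trans (truncnS_gt _) _.
by rewrite ler_nat ltnS leqW// leq_maxr.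
Qed.

End Prevalent.

Theorem theorem1p2 (R : realType) (theta : R) (a : decr_seq R)
  (theta_gt0 : 0 < theta) (theta_lt : theta < 1 / 4)
  (a_ratio : (fun n : nat => a n.+1 / a n) =O_ \oo (fun n : nat => theta ^+ n)) :
  prevalent [set f : little_lip a | PU f] /\ prevalent (lock_shift a).
Proof.
have rho1 := noise_rate_lt1 theta_lt.
have lock_prevalent : prevalent (lock_shift a).
  have [coin hcoin] := @coin_measure_exists R.
  have [mu muE] := image_prob coin (measurable_noise (a := a) theta_gt0 theta_lt).
  exists (~` lock_shift a); split=> //; first exact: measurable_not_lock.
  exists mu; split.
    exists (range (noise a coin_count (noise_rate_gt0 theta_gt0))); split.
      apply: continuous_compact; last exact: cantor_space_compact.
      by apply: continuous_subspaceT => c; exact: noise_continuous.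
    by apply: (etrans (muE _)); rewrite preimage_range; exact: probability_setT.
  move=> v; apply: (etrans (muE _)).
  have <- := coin_not_lock theta_gt0 theta_lt a_ratio hcoin (- v); congr (coin _).
  apply/seteqP; split => c /=.
    by move=> [F nF <-]; rewrite addrC addrK.
  by move=> h; exists (- v + noise a coin_count (noise_rate_gt0 theta_gt0) c); rewrite // addrC addrA subrr add0r.
split=> //; have [B [mB shyB sub]] := lock_prevalent; exists B; split=> //.
move=> f nPU; apply: sub => -[mu [umax per _]]; apply: nPU; split.
  exact: little_lip_continuous (a_small theta_gt0 theta_lt a_ratio).
by exists mu.
Qed.
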